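(* Let $r\ge3$, let $\mathbf c=(c[1],\ldots,c[r])\in\mathbb N^r$ with all $c[i]\ge1$, and let $t\in\{2,\ldots,r-1\}$. For an ordered collection $E=\{M_1,\ldots,M_r\}$ of multiplicity sequences and positive integers $p_1,\ldots,p_{r-1}$, put ${}^*p_i=\max(l(M_i),p_{i-1})$ for $2\le i\le r-1$, ${}^*p_1=l(M_1)$, $p_i^*=\max(l(M_{i+1}),p_{i+1})$ for $1\le i\le r-2$, $p_{r-1}^*=l(M_r)$. For $1\le a\le b\le r$ write $T_{[a,b]}=T_{\{M_a,\ldots,M_b\}}=(p_a,\ldots,p_{b-1})$. In all sets below, $T_E=(p_1,\ldots,p_{r-1})$ with $E=\{M_1,\ldots,M_r\}$. Define: $S_1^1(\mathbf c)$: the set of all $T_E$ such that $T_{[1,t]}\in\mathrm{Cond}((c[1],\ldots,c[t]))$, $T_{[t+1,r]}\in D((c[t+1],\ldots,c[r]))$ and $1\le p_t\le\min({}^*p_t,p_t^*,\mathrm{Comp}(M_t,M_{t+1}))$; $I_1(k)$, for $1\le k<c[t+1]$: the set of all $T_E$ such that $T_{[1,t]}\in\mathrm{Cond}((c[1],\ldots,c[t]))$, $T_{[t+1,r]}\in D((k,c[t+2],\ldots,c[r]))$ and $p_t=p_t^*+c[t+1]-k\le\min({}^*p_t,\mathrm{Comp}(M_t,M_{t+1}))$; $S_2^1(\mathbf c)$: the set of all $T_E$ such that $T_{[t,r]}\in\mathrm{Cond}((c[t],\ldots,c[r]))$, $T_{[1,t-1]}\in D((c[1],\ldots,c[t-1]))$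 and $1\le p_{t-1}\le\min({}^*p_{t-1},p_{t-1}^*,\mathrm{Comp}(M_{t-1},M_t))$; $I_2(k)$, for $1\le k<c[t-1]$: the set of all $T_E$ such that $T_{[t,r]}\in\mathrm{Cond}((c[t],\ldots,c[r]))$, $T_{[1,t-1]}\in D((c[1],\ldots,c[t-2],k))$ and $p_{t-1}={}^*p_{t-1}+c[t-1]-k\le\min(p_{t-1}^*,\mathrm{Comp}(M_{t-1},M_t))$. Put $S_1^2(\mathbf c)=\bigcup_{k=1}^{c[t+1]-1}I_1(k)$ and $S_2^2(\mathbf c)=\bigcup_{k=1}^{c[t-1]-1}I_2(k)$. Then $$\mathrm{Cond}(\mathbf c)=S_1^1(\mathbf c)\cup S_1^2(\mathbf c)\cup S_2^1(\mathbf c)\cup S_2^2(\mathbf c).$$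
   Context: $\mathbb N$ contains $0$, $\mathbb N^*=\mathbb N\setminus\{0\}$; $v[i]$ is the $i$-th component of a vector (or sequence) $v$; $\mathbb N^r$ has the componentwise partial order. Multiplicity sequences. A multiplicity sequence is a nonincreasing sequence $M=\{m_n\}_{n\ge1}$ in $\mathbb N^*$, eventually equal to $1$, such that for every $n\ge1$ there is $s(n)\ge n+1$ with $m_n=\sum_{k=n+1}^{s(n)}m_k$. If $M$ is not constant it is written $M=[m_1,\ldots,m_k]$ with $m_k$ the last entry different from $1$; the constant sequence is written $[1]$. The number $k$ of entries of this vector is the length $l(M)$ (so $l([1])=1$). A numerical semigroup $S$ (submonoid of $\mathbb N$ with finite complement) is Arf if $\{n\in S:n\ge s\}-s$ is a semigroup for each $s\in S$; Arf numerical semigroups correspond bijectively to multiplicity sequences via $M=[m_1,\ldots,m_k]\mapsto \{0,m_1,m_1+m_2,\ldots,m_1+\cdots+m_k\}\cup\{n: n>m_1+\cdots+m_k\}$ (with $[1]\mapsto\mathbb N$). For $n\in\mathbb N$, $\mathrm{Cond}(n)$ is the set of multiplicity sequences of Arf numerical semigroups with conductor $n$ (the conductor being the least $c$ such that all integers $\ge c$ lie in the semigroup). For $c\in\mathbb N^*$, $\mathrm{Cond}^*(c)=\mathrm{Cond}(c)$ if $c\ne1$ and $\mathrm{Cond}^*(1)=\mathrm{Cond}(0)=\{[1]\}$. Compatibility. For a multiplicity sequence $M_i$ and $k\ge1$ let $s_{i,k}$ be the integer with $M_i[k]=\sum_{l=k+1}^{s_{i,k}}M_i[l]$. For $M_i\ne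 M_j$, $\mathrm{Comp}(M_i,M_j)=\min\{\min(s_{i,k},s_{j,k}): k\ge1,\ s_{i,k}\ne s_{j,k}\}$; if $M_i=M_j$, $\mathrm{Comp}(M_i,M_j)=+\infty$. Good semigroups. A good semigroup $S\subseteq\mathbb N^r$ is a submonoid such that: (1) $\min(a,b)\in S$ (componentwise) for $a,b\in S$; (2) if $a,b\in S$ and $a[i]=b[i]$, there is $c\in S$ with $c[i]>a[i]$, $c[j]\ge\min(a[j],b[j])$ for $j\ne i$, with equality if $a[j]\ne b[j]$; (3) there is $\delta\in S$ with $\delta+\mathbb N^r\subseteq S$. Its conductor is the minimal vector $\mathbf c$ with $\mathbf c+\mathbb N^r\subseteq S$. All good semigroups considered are local: the zero vector is the only element with some zero component. $S$ is Arf if $\{\beta\in S:\beta\ge\alpha\}-\alpha$ is a semigroup for every $\alpha\in S$. Multiplicity trees. A local Arf good semigroup $S\subseteq \mathbb N^r$ is determined by its multiplicity tree $T$: a rooted tree with $r$ infinite branches, whose nodes are vectors $\mathbf n_i^j\in\mathbb N^r$ ($\mathbf n_i^j$ is the node of the $i$-th branch at level $j\ge1$; all branches share the root $\mathbf n_1^1$), with $S=\{\mathbf 0\}\cup\{\sum_{\mathbf n\in T'}\mathbf n : T' \text{ a finite subtree of } T \text{ rooted in } \mathbf n_1^1\}$. A tree is a multiplicity tree of a local Arf good semigroup iff: there is $L$ such that for $m\ge L$, $\mathbf n_i^m$ is the $i$-th unit vector for all $i$; $\mathbf n_i^j[h]=0$ iff $\mathbf n_i^j$ is not in the $h$-th branch;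 and each $\mathbf n_i^j$ equals the sum of the nodes different from $\mathbf n_i^j$ of some finite subtree rooted in $\mathbf n_i^j$. Two branches are glued at level $j$ if they share their node at level $j$. The sequence $M_i[j]=\mathbf n_i^j[i]$ is a multiplicity sequence. A multiplicity tree is described by the ordered collection $E=\{M_1,\ldots,M_r\}$ of the multiplicity sequences along its branches and by the integers $p_{i,j}\ge1$ ($i<j$), where $p_{i,j}$ is the highest level at which the $i$-th and $j$-th branches are glued. The tree is untwisted if two non-consecutive branches are glued at level $l$ if and only if all the consecutive branches between them are glued at a level $\ge l$; equivalently $p_{i,j}=\min\{p_{i,i+1},\ldots,p_{j-1,j}\}$ for $i<j$. An untwisted tree is denoted $T_E=(p_1,\ldots,p_{r-1})$ with $p_i=p_{i,i+1}$. For $s\ge2$ and $\mathbf u\in\mathbb N^s$, $\mathrm{Cond}(\mathbf u)$ is the set of all untwisted multiplicity trees of local Arf good semigroups in $\mathbb N^s$ with conductor $\mathbf u$. For $s\ge 1$ and $\mathbf u\in(\mathbb N^* )^s$, put $D(\mathbf u)=\mathrm{Cond}(\mathbf u)$ if $s\ge2$ and $D(\mathbf u)=\mathrm{Cond}^*(u[1])$ if $s=1$; in the latter case a ''tree'' $T_{\{M\}}=()$ on a single branch is identified with the multiplicity sequence $M$. *)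

(* Defs.v *)
From HB Require Import structures.
From mathcomp Require Import all_boot all_algebra.
From mathcomp Require Import boolp classical_sets cardinality.

Set Implicit Arguments.
Unset Strict Implicit.
Unset Printing Implicit Defensive.

Import GRing.Theory.

Local Open Scope classical_set_scope.
Local Open Scope nat_scope.

(* All indices (entries of sequences and vectors, branches of a descriptor,
   levels of a tree) are 1-based as in the text, except that the branches of an
   actual tree with s branches are indexed by 'I_s, the ordinal i standing for
   the branch i.+1. *)

(** * Multiplicity sequences *)

(* The sequence [m_1, ..., m_k] is stored as this finite vector; m_n = 1 for
   n > k. *)
Definition entry (M : seq nat) (n : nat) : nat := nth 1 M n.-1.

(* The first clause selects the unique vector representing a given sequence:
   either [1], or a vector whose last entry is different from 1 (note that
   last 1 [::] = 1). *)
Definition is_multseq (M : seq nat) : Prop :=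
  [/\ M = [:: 1] \/ last 1 M <> 1,
      (forall n, 1 <= n -> 0 < entry M n),
      (forall n, 1 <= n -> entry M n.+1 <= entry M n) &
      (forall n, 1 <= n -> exists s,
         n < s /\ entry M n = \sum_(n.+1 <= k < s.+1) entry M k)].

(* The index s with M[k] = M[k+1] + ... + M[s]; it exists and is unique as soon
   as M is a multiplicity sequence. *)
Definition sidx (M : seq nat) (k : nat) : nat :=
  xget 0 [set s | k < s /\ entry M k = \sum_(k.+1 <= l < s.+1) entry M l].

Definition is_least (A : set nat) (m : nat) : Prop :=
  A m /\ forall n, A n -> m <= n.

(* None stands for +oo. *)
Definition Comp (M N : seq nat) : option nat :=
  if M == N then None
  else Some (xget 0 [set m | is_least
         [set minn (sidx M k) (sidx N k) |
            k in [set k | 1 <= k /\ sidx M k <> sidx N k]] m]).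

Definition le_ext (p : nat) (c : option nat) : Prop :=
  if c is Some m then p <= m else True.

(** * Arf numerical semigroups *)

Definition submonoid (V : nmodType) (S : set V) : Prop :=
  S 0%R /\ forall a b, S a -> S b -> S (a + b)%R.

Definition numerical_semigroup (S : set nat) : Prop :=
  submonoid S /\ finite_set (~` S).

Definition arf_numerical (S : set nat) : Prop :=
  forall s, S s -> submonoid [set x | S (s + x)].

Definition conductor_numerical (S : set nat) : nat -> Prop :=
  is_least [set c | forall n, c <= n -> S n].

(* Partial sums m_1 + ... + m_j for 0 <= j <= k, and everything beyond the last
   one. *)
Definition numerical_of (M : seq nat) : set nat :=
  [set n | (exists2 j, j <= size M & n = sumn (take j M)) \/ sumn M < n].

Definition Cond1 (n : nat) : set (seq nat) :=
  [set M | is_multseq M /\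
     exists S : set nat, [/\ numerical_semigroup S, arf_numerical S,
       S = numerical_of M & conductor_numerical S n]].

Definition Cond1star (c : nat) : set (seq nat) :=
  if c == 1 then Cond1 0 else Cond1 c.

(** * Good semigroups *)

Section Good.
Variable s : nat.
Local Notation vect := {ffun 'I_s -> nat}.

Definition le_vect (a b : vect) : Prop := forall i, a i <= b i.

Definition good_semigroup (S : set vect) : Prop :=
  [/\ submonoid S,
      (forall a b, S a -> S b -> S [ffun i => minn (a i) (b i)]),
      (forall a b i, S a -> S b -> a i = b i ->
         exists c : vect, [/\ S c, a i < c i &
           forall j, j != i -> minn (a j) (b j) <= c j /\
             (a j <> b j -> c j = minn (a j) (b j))]) &
      exists2 d, S d & forall x : vect, S (d + x)%R].

Definition local_semigroup (S : set vect) : Prop :=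
  forall a i, S a -> a i = 0 -> a = 0%R.

Definition arf_semigroup (S : set vect) : Prop :=
  forall a, S a -> submonoid [set x : vect | S (a + x)%R].

Definition conductor (S : set vect) (c : vect) : Prop :=
  (forall x : vect, S (c + x)%R) /\
  forall c' : vect, (forall x : vect, S (c' + x)%R) -> le_vect c c'.

(** * Multiplicity trees *)

(* A family N gives the vector N i j labelling the node of the i-th branch at
   level j >= 1; the values N i 0 are irrelevant. Two branches share their node
   at level j when their vectors there are equal, so that a node is identified
   by its level together with its vector. *)
Definition family := 'I_s -> nat -> vect.
Definition node := (nat * {ffun 'I_s -> nat})%type.
Definition node_at (N : family) (i : 'I_s) (j : nat) : node := (j, N i j).

Definition glued (N : family) (i h : 'I_s) (j : nat) : Prop :=
  N i j = N h j.

Definition is_tree (N : family) : Prop :=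
  (forall i h, glued N i h 1) /\
  (forall i h j, 1 <= j -> glued N i h j.+1 -> glued N i h j).

(* A is the duplicate-free list of the nodes of a finite subtree rooted in the
   node of branch i at level j: each other node has its parent in A. *)
Definition subtree (N : family) (i : 'I_s) (j : nat) (A : seq node) : Prop :=
  [/\ uniq A, node_at N i j \in A &
      forall v, v \in A -> v = node_at N i j \/
        exists h l, [/\ j <= l, v = node_at N h l.+1 & node_at N h l \in A]].

Definition multiplicity_tree (N : family) : Prop :=
  [/\ is_tree N,
      (exists L, forall m, L <= m ->
         forall i, N i m = [ffun h => (h == i) : nat]),
      (forall i j h, 1 <= j -> N i j h = 0 <-> ~ glued N i h j) &
      (forall i j, 1 <= j -> exists2 A, subtree N i j A &
         N i j = (\sum_(v <- A | v != node_at N i j) v.2)%R)].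

Definition semigroup_of (N : family) : set vect :=
  [set a | a = 0%R \/
     exists i A, subtree N i 1 A /\ a = (\sum_(v <- A) v.2)%R].

Definition multiplicity_tree_of (S : set vect) (N : family) : Prop :=
  multiplicity_tree N /\ S = semigroup_of N.

Definition untwisted (N : family) : Prop :=
  forall (i j : 'I_s) l, i.+1 < j -> 1 <= l ->
    (glued N i j l <->
     forall k k' : 'I_s, i <= k -> k < j -> k' = k.+1 :> nat ->
       exists2 l', l <= l' & glued N k k' l').

Definition highest_glued (N : family) (i h : 'I_s) (p : nat) : Prop :=
  [/\ 1 <= p, glued N i h p & forall l, 1 <= l -> glued N i h l -> l <= p].

End Good.

(** * Descriptors T_E = (p_1, ..., p_{r-1}) *)

Record descriptor := Descriptor {
  seqs : seq (seq nat);   (* M_1, ..., M_r *)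
  glue : seq nat          (* p_1, ..., p_{r-1} *)
}.

Definition Mseq (T : descriptor) (i : nat) : seq nat := nth [:: 1] (seqs T) i.-1.
Definition pglue (T : descriptor) (i : nat) : nat := nth 0 (glue T) i.-1.
Definition comp_at (c : seq nat) (i : nat) : nat := nth 0 c i.-1.

Definition is_descriptor (r : nat) (T : descriptor) : Prop :=
  [/\ size (seqs T) = r, size (glue T) = r.-1,
      (forall M, M \in seqs T -> is_multseq M) &
      (forall p, p \in glue T -> 1 <= p)].

(* [x_a; ...; x_b], empty if b < a. *)
Definition slice (X : Type) (x : seq X) (a b : nat) : seq X :=
  drop a.-1 (take b x).

(* T_[a,b] *)
Definition subdesc (T : descriptor) (a b : nat) : descriptor :=
  Descriptor (slice (seqs T) a b) (slice (glue T) a b.-1).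

Definition describes (s : nat) (T : descriptor) (N : family s) : Prop :=
  (forall (i : 'I_s) j, 1 <= j -> entry (Mseq T i.+1) j = N i j i) /\
  (forall i h : 'I_s, h = i.+1 :> nat -> highest_glued N i h (pglue T i.+1)).

(* An untwisted tree is represented by its descriptor. *)
Definition Cond (u : seq nat) : set descriptor :=
  [set T | is_descriptor (size u) T /\
     exists N : family (size u), [/\ untwisted N, describes T N &
       exists S : set {ffun 'I_(size u) -> nat},
         [/\ good_semigroup S, local_semigroup S, arf_semigroup S,
             multiplicity_tree_of S N &
             conductor S [ffun i : 'I_(size u) => comp_at u i.+1]]]].

Definition D (u : seq nat) : set descriptor :=
  if size u == 1
  then [set Descriptor [:: M] [::] | M in Cond1star (comp_at u 1)]
  else Cond u.

(** * The sets of the decomposition *)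

(* The number r of branches is the size of c. *)

(* *p_i *)
Definition pstarl (T : descriptor) (i : nat) : nat :=
  if i == 1 then size (Mseq T 1) else maxn (size (Mseq T i)) (pglue T i.-1).

(* p_i^* *)
Definition pstarr (r : nat) (T : descriptor) (i : nat) : nat :=
  if i == r.-1 then size (Mseq T r)
  else maxn (size (Mseq T i.+1)) (pglue T i.+1).

Definition S11 (c : seq nat) (t : nat) : set descriptor :=
  let r := size c in
  [set T | [/\ is_descriptor r T,
     Cond (slice c 1 t) (subdesc T 1 t),
     D (slice c t.+1 r) (subdesc T t.+1 r),
     1 <= pglue T t <= minn (pstarl T t) (pstarr r T t) &
     le_ext (pglue T t) (Comp (Mseq T t) (Mseq T t.+1))]].

Definition I1 (c : seq nat) (t k : nat) : set descriptor :=
  let r := size c in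
  [set T | [/\ is_descriptor r T,
     Cond (slice c 1 t) (subdesc T 1 t),
     D (k :: slice c t.+2 r) (subdesc T t.+1 r),
     pglue T t = pstarr r T t + (comp_at c t.+1 - k) &
     pglue T t <= pstarl T t /\
     le_ext (pglue T t) (Comp (Mseq T t) (Mseq T t.+1))]].

Definition S12 (c : seq nat) (t : nat) : set descriptor :=
  \bigcup_(k in [set k | 1 <= k < comp_at c t.+1]) I1 c t k.

Definition S21 (c : seq nat) (t : nat) : set descriptor :=
  let r := size c in
  [set T | [/\ is_descriptor r T,
     Cond (slice c t r) (subdesc T t r),
     D (slice c 1 t.-1) (subdesc T 1 t.-1),
     1 <= pglue T t.-1 <= minn (pstarl T t.-1) (pstarr r T t.-1) &
     le_ext (pglue T t.-1) (Comp (Mseq T t.-1) (Mseq T t))]].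

Definition I2 (c : seq nat) (t k : nat) : set descriptor :=
  let r := size c in
  [set T | [/\ is_descriptor r T,
     Cond (slice c t r) (subdesc T t r),
     D (rcons (slice c 1 t.-2) k) (subdesc T 1 t.-1),
     pglue T t.-1 = pstarl T t.-1 + (comp_at c t.-1 - k) &
     pglue T t.-1 <= pstarr r T t.-1 /\
     le_ext (pglue T t.-1) (Comp (Mseq T t.-1) (Mseq T t))]].

Definition S22 (c : seq nat) (t : nat) : set descriptor :=
  \bigcup_(k in [set k | 1 <= k < comp_at c t.-1]) I2 c t k.

(* Main.v *)
Require Import Defs.
From mathcomp Require Import all_boot all_algebra.
From mathcomp Require Import boolp classical_sets cardinality.
From mathcomp Require Import zify.

(** The partial sums of the multiplicity sequences turn the elements of the
    semigroup of a tree into cuts: a cut chooses on each branch h the level e_h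
    where the subtree stops, two branches glued at level l having to agree up to
    level l.  In these coordinates the tree axioms say exactly that
    p_i <= Comp(M_i, M_{i+1}) for all i, the semigroup is then automatically good,
    local and Arf, and its conductor is c[i] = M_i[1] + ... + M_i[d_i] with
    d_i = max(l(M_i), p_{i-1}, p_i).
    The decomposition follows by cutting the tree between two consecutive
    branches.  If p_t <= *p_t, removing the branches after t does not change d_t;
    it does not change d_{t+1} either when p_t <= p_t^*, and otherwise, as all
    entries beyond l(M_{t+1}) are 1, it lowers c[t+1] by p_t - p_t^*.  If
    p_t > *p_t, then p_{t-1} < p_t <= p_{t-1}^*, and the cut between t-1 and t
    behaves symmetrically. *)

Set Implicit Arguments.
Unset Strict Implicit.
Unset Printing Implicit Defensive.

Local Open Scope classical_set_scope.
Local Open Scope nat_scope.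

(** * Multiplicity sequences *)

Definition psum (M : seq nat) (n : nat) : nat := \sum_(1 <= k < n.+1) entry M k.

Lemma psum0 M : psum M 0 = 0.
Proof. by rewrite /psum big_geq. Qed.

Lemma psumS M n : psum M n.+1 = psum M n + entry M n.+1.
Proof. by rewrite /psum big_nat_recr. Qed.

Lemma psum_split M k s : k <= s ->
  psum M s = psum M k + \sum_(k.+1 <= l < s.+1) entry M l.
Proof. by move=> ks; rewrite /psum (@big_cat_nat _ _ _ k.+1). Qed.

Lemma entry_tail M n : size M < n -> entry M n = 1.
Proof. by move=> Mn; rewrite /entry nth_default //; lia. Qed.

Lemma psum_tail M n k : size M <= n -> psum M (n + k) = psum M n + k.
Proof.
move=> Mn; elim: k => [|k IH]; first by rewrite !addn0.
by rewrite addnS psumS IH entry_tail; lia.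
Qed.

Lemma psum_take M n : n <= size M -> psum M n = sumn (take n M).
Proof.
elim: n => [|n IH] nM; first by rewrite psum0 take0.
by rewrite psumS IH ?(ltnW nM) // (take_nth 1) // sumn_rcons.
Qed.

Lemma psum_size M : psum M (size M) = sumn M.
Proof. by rewrite psum_take // take_size. Qed.

(** Induction towards the root, for properties that are clear far out, where all entries are 1, and
    pass from a level to the one before it. *)
Lemma downward_ind (K : nat) (P : nat -> Prop) :
  (forall n, K <= n -> P n) -> (forall n, P n.+1 -> P n) -> forall n, P n.
Proof.
move=> Pge Pstep n; have [/Pge //|nK] := leqP K n.
have := subnKC (ltnW nK); move: (K - n) => d; elim: d n {nK} => [|d IH] n dK.
  by apply: Pge; lia.
by apply: Pstep; apply: IH; lia.
Qed.

Section MultSeq.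
Variable M : seq nat.
Hypothesis hM : is_multseq M.

Lemma entry_gt0 n : 0 < n -> 0 < entry M n.
Proof. by case: hM => _ + _ _; exact. Qed.

Lemma leq_psum a b : (psum M a <= psum M b) = (a <= b).
Proof.
apply: leq_mono => {a b}; apply: homo_ltn; first exact: ltn_trans.
by move=> n; rewrite psumS -[X in X < _]addn0 ltn_add2l entry_gt0.
Qed.

Lemma ltn_psum a b : (psum M a < psum M b) = (a < b).
Proof. by rewrite !ltnNge leq_psum. Qed.

Lemma psum_inj : injective (psum M).
Proof. by move=> a b ab; apply/eqP; rewrite eqn_leq -(leq_psum a) -(leq_psum b) ab leqnn. Qed.

Lemma psum_min a b : psum M (minn a b) = minn (psum M a) (psum M b).
Proof. by rewrite /minn ltn_psum; case: ifP. Qed.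

Lemma size_multseq : 0 < size M.
Proof. by case: hM => -[->//|]; case: (M). Qed.

Lemma sidxP k : 0 < k ->
  k < sidx M k /\ psum M (sidx M k) = psum M k + entry M k.
Proof.
move=> k0; rewrite /sidx; case: xgetP => [s _ [ks ->]|].
  by rewrite ks -psum_split // ltnW.
by case: hM => _ _ _ /(_ k k0) [s hs] /(_ s).
Qed.

Lemma sidx_unique k s : 0 < k -> psum M s = psum M k + entry M k -> s = sidx M k.
Proof. by move=> k0 hs; apply: psum_inj; rewrite (sidxP k0).2. Qed.

(** The Arf property of the set of partial sums: an element plus two differences above it is again a
    partial sum. The bound on [f] keeps [f1] above [e.+1], as the second use of the induction
    hypothesis requires. *)
Lemma psum_arf e a b : e <= a -> e <= b ->
  exists2 f, maxn a b <= f & psum M a + psum M b = psum M e + psum M f.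
Proof.
move: e a b; apply: (@downward_ind (size M)) => [e Me|e IH] a b ea eb.
  exists (e + ((a - e) + (b - e))); first lia.
  by rewrite -(subnKC ea) -(subnKC eb) !psum_tail //; lia.
(* F(a) + F(b) - F(e) = (F(a) + F(b) - F(e+1)) + F(sidx M (e+1)) - F(e+1) for
   F = psum M, so that two uses of the case e+1 suffice. *)
have [ea'|ea'] := eqVneq e a; first by exists b; [lia|rewrite ea'].
have [eb'|eb'] := eqVneq e b; first by exists a; [lia|rewrite eb' addnC].
have [|se hs] := @sidxP e.+1; first by [].
have [||f1 abf1 hf1] := IH a b; [lia..|].
have [||f f1f hf] := IH f1 (sidx M e.+1); [lia..|].
by exists f; [lia|]; move: hs hf1 hf; rewrite !psumS; lia.
Qed.

End MultSeq.

(** The condition p <= Comp(M, N): at each k the two indices agree or both are at least [p]. The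
    truncated form is visibly an equivalence relation in [M] and [N], and it covers M = N. *)
Definition compatible (p : nat) (M N : seq nat) : Prop :=
  forall k, 0 < k -> minn (sidx M k) p = minn (sidx N k) p.

Lemma compatible_sym p M N : compatible p M N -> compatible p N M.
Proof. by move=> h k k0; rewrite h. Qed.

Lemma compatible_trans p M N Q :
  compatible p M N -> compatible p N Q -> compatible p M Q.
Proof. by move=> h h' k k0; rewrite h // h'. Qed.

Lemma compatible_le p q M N : q <= p -> compatible p M N -> compatible q M N.
Proof. by move=> qp h k /h; lia. Qed.

(** For compatible sequences the level [f] of [psum_arf], truncated at [p], depends only on the
    truncations of [e], [a], [b]. The downward induction of [psum_arf] is run on both sequences in
    parallel; from level [p] on, all truncations equal [p]. *)
Lemma psum_arf_compatible p M N e a b f e' a' b' f' :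
  is_multseq M -> is_multseq N -> compatible p M N ->
  e <= a -> e <= b -> e' <= a' -> e' <= b' ->
  minn e p = minn e' p -> minn a p = minn a' p -> minn b p = minn b' p ->
  psum M a + psum M b = psum M e + psum M f ->
  psum N a' + psum N b' = psum N e' + psum N f' ->
  minn f p = minn f' p.
Proof.
move=> hM hN cMN.
have lef Q e0 a0 b0 f0 : is_multseq Q -> e0 <= a0 -> e0 <= b0 ->
    psum Q a0 + psum Q b0 = psum Q e0 + psum Q f0 -> maxn a0 b0 <= f0.
  move=> hQ; rewrite -(leq_psum hQ e0 a0) -(leq_psum hQ e0 b0) => ea eb E.
  by rewrite geq_max -!(leq_psum hQ _ f0); lia.
move: e a b f e' a' b' f'; apply: (@downward_ind p) => [e pe|e IH] a b f
  e' a' b' f' ea eb ea' eb' he ha hb hf hf'.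
  by have := lef _ _ _ _ _ hM ea eb hf; have := lef _ _ _ _ _ hN ea' eb' hf'; lia.
have mf := lef _ _ _ _ _ hM ea eb hf; have mf' := lef _ _ _ _ _ hN ea' eb' hf'.
have [pe|ep] := leqP p e; first lia.
have ee : e' = e by lia.
rewrite {}ee in ea' eb' he hf' *.
have [e_a|e_a] := eqVneq e a.
  have -> : f = b by apply: (psum_inj hM); rewrite -e_a in hf; lia.
  have ea2 : e = a' by lia.
  have -> // : f' = b' by apply: (psum_inj hN); rewrite -ea2 in hf'; lia.
have [e_b|e_b] := eqVneq e b.
  have -> : f = a by apply: (psum_inj hM); rewrite -e_b in hf; lia.
  have eb2 : e = b' by lia.
  have -> // : f' = a' by apply: (psum_inj hN); rewrite -eb2 in hf'; lia.
have [|se hs] := @sidxP M hM e.+1; first by [].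
have [|se' hs'] := @sidxP N hN e.+1; first by [].
have [||f1 abf1 hf1] := psum_arf hM (e := e.+1) (a := a) (b := b); [lia..|].
have [||f1' abf1' hf1'] := psum_arf hN (e := e.+1) (a := a') (b := b'); [lia..|].
have E1 : minn f1 p = minn f1' p by apply: (IH a b f1 e.+1 a' b' f1') => //; lia.
(* Compatibility enters here only: it says that the truncations of [sidx M e.+1] and [sidx N e.+1]
   agree. *)
apply: (IH f1 (sidx M e.+1) f e.+1 f1' (sidx N e.+1) f') => //; try lia.
- exact: cMN.
- by move: hf hs hf1; rewrite !psumS; lia.
- by move: hf' hs' hf1'; rewrite !psumS; lia.
Qed.

(** The normal form of the vectors makes this work: if one of them were longer, its last entry would
    be a tail entry of the other, hence 1. *)
Lemma multseq_entry_inj M N : is_multseq M -> is_multseq N ->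
  (forall k, 0 < k -> entry M k = entry N k) -> M = N.
Proof.
move=> hM hN E.
have leN P Q : is_multseq P -> is_multseq Q ->
    (forall k, 0 < k -> entry P k = entry Q k) -> size P <= size Q.
  move=> hP hQ EPQ; case: (hP) => + _ _ _; case=> [->|lP].
    exact: (size_multseq hQ).
  rewrite leqNgt; apply/negP => QP; apply: lP; rewrite -nth_last.
  exact: etrans (EPQ _ (size_multseq hP)) (entry_tail QP).
have sMN : size M = size N.
  by apply/eqP; rewrite eqn_leq !leN // => k /E ->.
by apply: (eq_from_nth (x0 := 1)) => // i _; apply: (E i.+1).
Qed.

(** All entries far out are 1, and each entry is the sum of the later ones up to [sidx], so the
    entries are recovered downwards. The induction carries equality of all entries beyond [k]. *)
Lemma sidx_ext M N : is_multseq M -> is_multseq N ->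
  (forall k, 0 < k -> sidx M k = sidx N k) -> M = N.
Proof.
move=> hM hN E; apply: multseq_entry_inj => //.
suff H : forall k j, k < j -> entry M j = entry N j by move=> k /H.
apply: (@downward_ind (maxn (size M) (size N))) => [k kK j kj|k IH j].
  by rewrite !entry_tail //; lia.
rewrite leq_eqVlt => /predU1P[<-|/IH//].
have [|sM hsM] := @sidxP M hM k.+1; first by [].
have [|sN hsN] := @sidxP N hN k.+1; first by [].
move: hsM; rewrite (psum_split _ (ltnW sM)) => /addnI <-.
move: hsN; rewrite (psum_split _ (ltnW sN)) => /addnI <-.
by rewrite -E //; apply: eq_big_nat => l /andP[/IH].
Qed.

(** When the sequences differ, [sidx_ext] makes the set under the minimum nonempty, so [xget]
    returns its least element and not the default 0. *)
Lemma le_ext_CompP p M N : is_multseq M -> is_multseq N ->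
  le_ext p (Comp M N) <-> compatible p M N.
Proof.
move=> hM hN; rewrite /Comp; case: eqVneq => [->|/eqP MN] /=.
  by split.
set A := [set minn _ _ | _ in _].
have [k0 [k0_gt0 k0P]] : exists k, 0 < k /\ sidx M k <> sidx N k.
  apply: contrapT => H; apply: MN; apply: sidx_ext => // k k0.
  by apply: contrapT => nE; apply: H; exists k.
have exA : exists m, `[< A m >].
  by exists (minn (sidx M k0) (sidx N k0)); apply/asboolP; exists k0.
case: xgetP => [m _ [[k1 [k1_gt0 k1P] <-] mmin]|H]; last first.
  case: (ex_minnP exA) => m /asboolP Am mmin.
  by case: (H m); split=> // n An; apply: mmin; apply/asboolP.
split=> [pm k k_gt0|cp]; last by have := cp _ k1_gt0; lia.
have [->//|/eqP ne] := eqVneq (sidx M k) (sidx N k).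
have : minn (sidx M k1) (sidx N k1) <= minn (sidx M k) (sidx N k).
  by apply: mmin; exists k.
lia.
Qed.

(** * Cuts of a multiplicity tree and its semigroup *)

(* e h is the last level of branch h in a finite subtree rooted in the node of
   branch i at level j. *)
Definition cut s (N : Defs.family s) (i : 'I_s) (j : nat) (e : 'I_s -> nat) : Prop :=
  (forall h, glued N i h j -> j <= e h) /\
  (forall h h' l, glued N i h j -> j <= l -> glued N h h' l ->
     minn (e h) l = minn (e h') l).

(* The elements of the semigroup correspond to the admissible e, the zero vector
   to e = 0. *)
Definition admissible s (N : Defs.family s) (e : 'I_s -> nat) : Prop :=
  forall h h' l, 0 < l -> glued N h h' l -> minn (e h) l = minn (e h') l.

Definition cut_below s (N : Defs.family s) (i : 'I_s) (j : nat) (A : seq (node s))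
    (e : 'I_s -> nat) : Prop :=
  forall h l, glued N i h j -> j <= l -> (node_at N h l \in A) = (l <= e h).

Lemma sum_coord s (I : Type) (A : seq I) (P : pred I)
    (F : I -> {ffun 'I_s -> nat}) (h : 'I_s) :
  (\sum_(v <- A | P v) F v)%R h = \sum_(v <- A | P v) F v h.
Proof.
by apply: (big_morph (fun x : {ffun 'I_s -> nat} => x h)) => [x y|]; rewrite ffunE.
Qed.

Section Tree.
Variables (s : nat) (N : Defs.family s) (M : 'I_s -> seq nat).
Hypothesis treeN : is_tree N.
Hypothesis N_eq0 : forall i j h, 1 <= j -> N i j h = 0 <-> ~ glued N i h j.
Hypothesis entryM : forall i j, 1 <= j -> entry (M i) j = N i j i.
Hypothesis hM : forall i, is_multseq (M i).

Lemma glued_le i h k j : 0 < k -> k <= j -> glued N i h j -> glued N i h k.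
Proof.
move=> k0 /subnKC <-; elim: (j - k) => [|d IH]; first by rewrite addn0.
by rewrite addnS => g; apply: IH; apply: treeN.2 => //; lia.
Qed.

Lemma node_coord i j h : 0 < j -> glued N i h j -> N i j h = entry (M h) j.
Proof. by move=> j0 ->; rewrite entryM. Qed.

(** Induction on the level along parents. The parent may be presented through another branch, but
    the two branches then share that node. *)
Lemma subtree_mem i j A v : 0 < j -> subtree N i j A -> v \in A ->
  exists h l, [/\ j <= l, glued N i h j & v = node_at N h l].
Proof.
move=> j0 [_ _ par].
have [n vn] : exists n, v.1 < n by exists v.1.+1.
elim: n v vn => // n IH v vn /par [->|[h [l [jl vE]]]]; first by exists i, j.
have ln : l < n by move: vn; rewrite vE /=; lia.
case/(IH (node_at N h l) ln) => h' [l' [_ g [el eN]]]; subst l'.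
exists h, l.+1; split=> //; first lia.
by rewrite /glued g; apply/esym; apply: (glued_le j0 jl).
Qed.

Lemma subtree_parent i j A h l : 0 < j -> subtree N i j A -> j <= l ->
  node_at N h l.+1 \in A -> node_at N h l \in A.
Proof.
move=> j0 [_ _ par] jl /par [[]|]; first lia.
case=> h' [l' [_ [<- /treeN.2 g]]]; rewrite /node_at g //; lia.
Qed.

(** Take for [e h] the highest level of a node of [A] on branch [h]; closure under parents fills the
    levels below it. Glued branches have the same nodes up to level [l], so their values of [e]
    agree up to [l]. *)
Lemma subtree_cut i j A : 0 < j -> subtree N i j A ->
  exists2 e, cut N i j e & cut_below N i j A e.
Proof.
move=> j0 hA.
have H h : exists n, glued N i h j ->
    j <= n /\ forall l, j <= l -> (node_at N h l \in A) = (l <= n).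
  (* On branches that miss the root of the subtree nothing is asked of [e]. *)
  have [g|ng] := pselect (glued N i h j); last by exists 0.
  have rootA : node_at N h j \in A by rewrite /node_at -g; case: hA.
  have bnd l : node_at N h l \in A -> l <= \max_(v <- A) v.1.
    by move=> lA; exact: (leq_bigmax_seq (F := fun v : node s => v.1) (node_at N h l) lA isT).
  have exA : exists l, node_at N h l \in A by exists j.
  case: (ex_maxnP exA bnd) => n nA nmax; exists n => _; split; first exact: nmax.
  move=> l jl; apply/idP/idP; first exact: nmax.
  move=> ln; rewrite -(subnKC ln) in nA.
  elim: (n - l) nA => [|d IH]; first by rewrite addn0.
  rewrite addnS => nA; apply/IH/(subtree_parent j0 hA _ nA); lia.
have [e he] := choice H; exists e; last by move=> h l /he[_]; exact.
split=> [h /he[]//|h h' l g jl g'].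
have gih' : glued N i h' j by rewrite /glued g; apply: glued_le g'.
have [je eP] := he _ g; have [je' eP'] := he _ gih'.
have E k : j <= k -> k <= l -> (k <= e h) = (k <= e h').
  move=> jk kl; rewrite -eP // -eP' // /node_at.
  by rewrite (glued_le _ kl g') //; lia.
have [eh|eh] := ltnP (e h) (e h').
  by have := E (e h).+1; lia.
by have := E (e h').+1; lia.
Qed.

(** Collect the nodes up to level [e h] on each branch through the root, removing the repetitions
    caused by glued branches. The cut condition makes membership independent of the branch through
    which a node is presented. *)
Lemma cut_subtree i j e : 0 < j -> cut N i j e ->
  exists2 A, subtree N i j A & cut_below N i j A e.
Proof.
move=> j0 [je ce].
pose B := [seq node_at N h l | h <- [seq h <- enum 'I_s | N i j == N h j],
                               l <- index_iota j (e h).+1].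
have memB v : reflect
    (exists h l, [/\ glued N i h j, j <= l <= e h & v = node_at N h l])
    (v \in undup B).
  rewrite mem_undup; apply: (iffP allpairsPdep) => -[h [l [hP lP ->]]].
    exists h, l; move: hP lP; rewrite mem_filter mem_index_iota => /andP[/eqP g _].
    by rewrite ltnS.
  by exists h, l; rewrite mem_filter mem_enum inE andbT hP mem_index_iota ltnS.
have below : cut_below N i j (undup B) e.
  move=> h l g jl; apply/memB/idP => [[h' [l' [g' /andP[_ le'] [ll gl]]]]|le].
    by rewrite -{}ll in le' gl; have := ce _ _ _ g' jl (esym gl); lia.
  by exists h, l; split=> //; rewrite jl.
exists (undup B) => //; split; first exact: undup_uniq.
  by rewrite below // je.
move=> v /memB[h [l [g /andP[jl le] ->]]].
move: jl le; rewrite leq_eqVlt => /predU1P[<- _|jl le].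
  by left; rewrite /node_at g.
case: l => // l in jl le *; right; exists h, l; split=> //.
by rewrite below // ltnW.
Qed.

(** Coordinate [h] sees only the nodes on branch [h], all others being zero there; these contribute
    the entries of [M h] from [j] to [e h]. *)
Lemma subtree_sum i j A e h : 0 < j -> subtree N i j A -> cut_below N i j A e ->
  glued N i h j -> j <= e h ->
  psum (M h) j.-1 + (\sum_(v <- A) v.2)%R h = psum (M h) (e h).
Proof.
move=> j0 hA eA g je; rewrite (@psum_split _ j.-1 (e h)) ?prednK //; last lia.
congr (_ + _); rewrite sum_coord (bigID (fun v : node s => v.2 h == 0)) /=.
rewrite big1 => [|v /eqP //]; rewrite add0n -big_filter.
have -> : \sum_(j <= l < (e h).+1) entry (M h) l =
    \sum_(v <- map (node_at N h) (index_iota j (e h).+1)) v.2 h.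
  rewrite big_map !big_seq; apply: eq_bigr => l.
  by rewrite mem_index_iota => jl; rewrite entryM //; lia.
apply/perm_big/uniq_perm.
- by rewrite filter_uniq //; case: hA.
- by rewrite map_inj_uniq ?iota_uniq // => l l' [].
move=> v; rewrite mem_filter; apply/andP/mapP => [[vh vA]|[l + ->]].
  have [h' [l [jl g' vE]]] := subtree_mem j0 hA vA; rewrite {v}vE in vh vA *.
  have gl : N h' l = N h l.
    apply: contrapT => ng; move/eqP: vh; apply.
    by apply/N_eq0 => //; lia.
  exists l; last by rewrite /node_at gl.
  by rewrite mem_index_iota jl ltnS -eA // /node_at -gl.
rewrite mem_index_iota ltnS => /andP[jl le]; rewrite eA //; split=> //=.
by rewrite -entryM ?(leq_trans j0) // -lt0n entry_gt0 // (leq_trans j0).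
Qed.

Lemma subtree_sum_unglued i j A h : 0 < j -> subtree N i j A ->
  ~ glued N i h j -> (\sum_(v <- A) v.2)%R h = 0.
Proof.
move=> j0 hA ng; rewrite sum_coord big_seq big1 // => v.
case/(subtree_mem j0 hA) => h' [l [jl g ->]] /=; apply/N_eq0; first lia.
by move=> /(glued_le j0 jl) g'; apply: ng; rewrite /glued g.
Qed.

Lemma subtree_sum_root i j A : subtree N i j A ->
  (\sum_(v <- A) v.2 = N i j + \sum_(v <- A | v != node_at N i j) v.2)%R.
Proof. by case=> uA rA _; rewrite (bigD1_seq _ rA uA). Qed.

Definition psums (e : 'I_s -> nat) : {ffun 'I_s -> nat} :=
  [ffun h => psum (M h) (e h)].

(** All branches share the root, so an admissible [e] vanishes everywhere or nowhere: the first case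
    is the zero vector, the second is the cut of a subtree rooted at level 1. *)
Lemma semigroup_ofP a :
  semigroup_of N a <-> exists2 e, admissible N e & a = psums e.
Proof.
split=> [[->|[i [A [hA ->]]]]|[e eN ->]].
- by exists (fun=> 0) => //; apply/ffunP => h; rewrite !ffunE psum0.
- have [//|e [e1 ce] eA] := subtree_cut _ hA.
  exists e => [h h' l l0 g|]; first exact: ce (treeN.1 _ _) l0 g.
  apply/ffunP => h; rewrite ffunE -(subtree_sum _ hA eA) ?psum0 //.
    exact: treeN.1.
  exact/e1/treeN.1.
have [e0|] := pselect (forall h, e h = 0).
  by left; apply/ffunP => h; rewrite !ffunE e0 psum0.
move=> /existsNP[i /eqP ei]; right.
have e_gt0 h : 0 < e h by have := eN i h 1 isT (treeN.1 _ _); lia.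
have ce : cut N i 1 e by split=> [h _ //|h h' l _ l0 g]; apply: eN.
have [//|A hA eA] := cut_subtree _ ce; exists i, A; split=> //.
apply/ffunP => h; rewrite ffunE -(subtree_sum _ hA eA) ?psum0 //.
exact: treeN.1.
Qed.

(** A subtree rooted in a node and summing, apart from that node, to the node itself must stop at
    level [sidx (M i) k] on every branch [i] through it. The cut condition for this subtree is then
    the compatibility. *)
Lemma glued_compatible :
  (forall i j, 1 <= j -> exists2 A, subtree N i j A &
     N i j = (\sum_(v <- A | v != node_at N i j) v.2)%R) ->
  forall h h' l, 0 < l -> glued N h h' l -> compatible l (M h) (M h').
Proof.
move=> sumN h h' l l0 g k k0; have [hs _] := sidxP (hM h) k0.
have [hs' _] := sidxP (hM h') k0.
have [lk|kl] := leqP l k; first lia.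
have [A hA NA] := sumN h k k0; have [e [ke ce] eA] := subtree_cut k0 hA.
have eE i : glued N h i k -> e i = sidx (M i) k.
  move=> gi; apply: sidx_unique => //; rewrite -(subtree_sum _ hA eA) ?ke //.
  rewrite (subtree_sum_root hA) -NA ffunE (node_coord _ gi) //.
  have := psumS (M i) k.-1; rewrite prednK // => ->; lia.
rewrite -!eE //; last exact: glued_le (ltnW kl) g.
exact: ce (ltnW kl) g.
Qed.

(** Conversely, compatibility says that the levels [sidx (M h) j] form a cut, and its subtree is the
    required one. *)
Lemma compatible_sum_node :
  (forall h h' l, 0 < l -> glued N h h' l -> compatible l (M h) (M h')) ->
  forall i j, 1 <= j -> exists2 A, subtree N i j A &
     N i j = (\sum_(v <- A | v != node_at N i j) v.2)%R.
Proof.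
move=> cM i j j0.
have js h : j < sidx (M h) j by case: (sidxP (hM h) j0).
have ce : cut N i j (fun h => sidx (M h) j).
  split=> [h _|h h' l _ jl g]; first exact: ltnW.
  by apply: (cM h h' l) => //; lia.
have [A hA eA] := cut_subtree j0 ce; exists A => //; apply/ffunP => h.
have [g|ng] := pselect (glued N i h j).
  have := subtree_sum j0 hA eA g (ltnW (js h)).
  rewrite (subtree_sum_root hA) ffunE (sidxP (hM h) j0).2 (node_coord _ g) //.
  have := psumS (M h) j.-1; rewrite prednK // => ->.
  by rewrite -addnA => /addnI/addnI ->.
have := subtree_sum_unglued j0 hA ng.
by rewrite (subtree_sum_root hA) ffunE => /eqP; rewrite addn_eq0 => /andP[/eqP-> /eqP->].
Qed.

(** * Goodness, Arf property and conductor of the semigroup of cuts *)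

Section Good.
Hypothesis cM : forall h h' l, 0 < l -> glued N h h' l -> compatible l (M h) (M h').

Lemma semigroup_of_local : local_semigroup (semigroup_of N).
Proof.
move=> a i /semigroup_ofP[e eN ->]; rewrite ffunE -(psum0 (M i)) => /psum_inj e0.
apply/ffunP => h; rewrite !ffunE.
have := eN i h 1 isT (treeN.1 _ _); rewrite e0 // => eh.
have -> : e h = 0 by lia.
exact: psum0.
Qed.

(** [psum_arf] solves the problem on each branch separately, and [psum_arf_compatible] shows that
    the levels found form an admissible family. *)
Lemma semigroup_of_arf : arf_semigroup (semigroup_of N).
Proof.
move=> a Sa; split=> /= [|x y]; first by rewrite GRing.addr0.
have /semigroup_ofP[e eN ->] := Sa.
move=> /semigroup_ofP[e1 eN1 E1] /semigroup_ofP[e2 eN2 E2].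
have D1 h : psum (M h) (e h) + x h = psum (M h) (e1 h).
  by move/ffunP: E1 => /(_ h); rewrite !ffunE.
have D2 h : psum (M h) (e h) + y h = psum (M h) (e2 h).
  by move/ffunP: E2 => /(_ h); rewrite !ffunE.
have le1 h : e h <= e1 h by rewrite -(leq_psum (hM h)) -D1 leq_addr.
have le2 h : e h <= e2 h by rewrite -(leq_psum (hM h)) -D2 leq_addr.
have H h : exists f,
    psum (M h) (e1 h) + psum (M h) (e2 h) = psum (M h) (e h) + psum (M h) f.
  by have [f _ hf] := psum_arf (hM h) (le1 h) (le2 h); exists f.
have [f hf] := choice H; apply/semigroup_ofP; exists f.
  move=> h h' l l0 g.
  apply: (psum_arf_compatible (hM h) (hM h') (cM l0 g) (le1 h) (le2 h) (le1 h')
    (le2 h') _ _ _ (hf h) (hf h')); [exact: eN|exact: eN1|exact: eN2].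
apply/ffunP => h; rewrite !ffunE; move: (hf h).
by rewrite -D1 -D2 -addnA => /addnI <-; apply: addnCA.
Qed.

(** Closure under addition is the Arf condition at the element 0. *)
Lemma semigroup_of_submonoid : submonoid (semigroup_of N).
Proof.
have S0 : semigroup_of N 0%R by left.
split=> // a b Sa Sb; have [_ add] := semigroup_of_arf S0.
by have := add a b; rewrite /= !GRing.add0r; apply.
Qed.

Lemma semigroup_of_min a b : semigroup_of N a -> semigroup_of N b ->
  semigroup_of N [ffun i => minn (a i) (b i)].
Proof.
move=> /semigroup_ofP[e eN ->] /semigroup_ofP[e' eN' ->]; apply/semigroup_ofP.
exists (fun h => minn (e h) (e' h)) => [h h' l l0 g|].
  by have := eN h h' l l0 g; have := eN' h h' l l0 g; lia.
by apply/ffunP => h; rewrite !ffunE psum_min.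
Qed.

(** Take the minimum of the two cuts and raise it by one level exactly on the branches glued with
    [i] at level [(e i).+1]. On these both cuts stop at [e i], so there the two vectors agree and no
    equality is demanded. *)
Lemma semigroup_of_raise a b i : semigroup_of N a -> semigroup_of N b ->
  a i = b i ->
  exists c : {ffun 'I_s -> nat}, [/\ semigroup_of N c, a i < c i &
    forall j, j != i -> minn (a j) (b j) <= c j /\
      (a j <> b j -> c j = minn (a j) (b j))].
Proof.
move=> /semigroup_ofP[e eN ->] /semigroup_ofP[e' eN' ->].
rewrite !ffunE => /(psum_inj (hM i)) ei; pose l := (e i).+1.
pose f h := if N i l == N h l then l else minn (e h) (e' h).
have class h : glued N i h l -> e h = e i /\ e' h = e i.
  by move=> g; have := eN i h l isT g; have := eN' i h l isT g; lia.
exists (psums f); split.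
- apply/semigroup_ofP; exists f => // h h' k k0 g.
  have em := eN h h' k k0 g; have em' := eN' h h' k k0 g.
  (* A raised branch and one that is not raised can be glued only below level [l], where the raise
     is invisible. *)
  have low h1 h2 : glued N i h1 l -> ~ glued N i h2 l -> glued N h1 h2 k -> k < l.
    move=> g1 g2 gk; rewrite ltnNge; apply/negP => lk; apply: g2.
    by rewrite /glued g1; apply: glued_le lk gk.
  rewrite /f; case: eqP => gh; case: eqP => gh'; rewrite ?ei; try lia.
    by have := low _ _ gh gh' g; have := class h gh; lia.
  by have := low _ _ gh' gh (esym g); have := class h' gh'; lia.
- by rewrite !ffunE /f eqxx ltn_psum.
move=> j _; rewrite !ffunE -psum_min // /f; case: eqP => [/class [-> ->]|_].
  by split=> //; rewrite leq_psum // minnn /l.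
by split.
Qed.

(** Beyond [d] all entries are 1 and no two branches are glued, so every vector above [psums d]
    comes from a cut. Each [d h] is minimal because it is forced either by a last entry different
    from 1 or by a glueing with another branch. *)
Lemma semigroup_of_conductor (d : 'I_s -> nat) :
  (forall h, 0 < d h) -> (forall h, size (M h) <= d h) ->
  (forall h h' l, h <> h' -> 0 < l -> glued N h h' l -> l <= d h) ->
  (forall h, (d h = size (M h) /\ last 1 (M h) <> 1) \/
     exists2 h', h <> h' & glued N h h' (d h)) ->
  conductor (semigroup_of N) (psums d).
Proof.
move=> d0 dsz dub dlub; split=> [x|c' hc' h].
  apply/semigroup_ofP; exists (fun h => d h + x h) => [h h' l l0 g|].
    have [->//|/eqP hh'] := eqVneq h h'.
    by have := dub h h' l hh' l0 g; have := dub h' h l (nesym hh') l0 (esym g); lia.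
  by apply/ffunP => h; rewrite !ffunE psum_tail.
rewrite leqNgt; apply/negP; rewrite ffunE => ltc.
(* If [c' h] were too small, this [x] would put into the semigroup a vector with coordinate
   [psum (M h) (d h)] minus 1 at [h] and large coordinates elsewhere. Its cut stops at [d h] minus 1
   on branch [h]. *)
pose x : {ffun 'I_s -> nat} :=
  [ffun k => if k == h then (psum (M h) (d h)).-1 - c' h else psum (M k) (d k)].
have /semigroup_ofP[e eN /ffunP E] := hc' x.
have := E h; rewrite !ffunE eqxx => Eh.
have aux (u v w : nat) : u < v -> u + (v.-1 - u) = w -> v = w.+1 by lia.
have pe : psum (M h) (d h) = (psum (M h) (e h)).+1 by exact: aux ltc Eh.
have ed : e h < d h by rewrite -(ltn_psum (hM h)) pe.
have de : d h <= (e h).+1.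
  rewrite -(leq_psum (hM h)) pe psumS -[X in X < _]addn0 ltn_add2l.
  exact: entry_gt0.
have {ed de} de : d h = (e h).+1 by lia.
have [[dS lM]|[h' hh' g]] := dlub h.
  apply: lM; rewrite -nth_last -dS; move: pe; rewrite {1}de psumS -de /entry.
  lia.
have := E h'; rewrite !ffunE eq_sym; case: eqP => // _ Eh'.
have : d h' <= e h' by rewrite -(leq_psum (hM h')) -Eh' leq_addl.
have := dub h' h (d h) (nesym hh') (d0 h) (esym g).
by have := eN h h' (d h) (d0 h) g; lia.
Qed.

Lemma semigroup_of_good c :
  conductor (semigroup_of N) c -> good_semigroup (semigroup_of N).
Proof.
move=> [hc _]; split.
- exact: semigroup_of_submonoid.
- exact: semigroup_of_min.
- exact: semigroup_of_raise.
- by exists c => //; have := hc 0%R; rewrite GRing.addr0.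
Qed.

End Good.
End Tree.

(** * Untwisted trees and their descriptors *)

(** Glueing at level [j] in the untwisted tree of [T], that is, j is at most the minimum of the p
    between the two branches. Branches are numbered from 0 here, so [k] and [k.+1] are separated by
    [pglue T k.+1]. *)
Definition joined (T : descriptor) (a b j : nat) : Prop :=
  forall k, minn a b <= k < maxn a b -> j <= pglue T k.+1.

(* No boundary case is needed: pglue T 0 = pglue T 1, and pglue T s = 0 when T
   has s branches. *)
Definition level (T : descriptor) (i : nat) : nat :=
  maxn (size (Mseq T i)) (maxn (pglue T i.-1) (pglue T i)).

Lemma joined_refl T a j : joined T a a j.
Proof. by move=> k; lia. Qed.

Lemma joined_sym T a b j : joined T a b j -> joined T b a j.
Proof. by move=> ab k; rewrite minnC maxnC; apply: ab. Qed.

Lemma joined_trans T a b c j : joined T a b j -> joined T b c j -> joined T a c j.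
Proof.
move=> ab bc k kac.
by have [/ab //|/bc //] : minn a b <= k < maxn a b \/ minn b c <= k < maxn b c; lia.
Qed.

Lemma joined_le T a b l j : l <= j -> joined T a b j -> joined T a b l.
Proof. by move=> lj ab k /ab; apply: leq_trans. Qed.

Lemma joined_next T a j : joined T a a.+1 j <-> j <= pglue T a.+1.
Proof.
split=> [/(_ a)|ja k ak]; first by apply; lia.
by have -> : k = a by lia.
Qed.

Lemma conductor_unique s (S : set {ffun 'I_s -> nat}) c c' :
  conductor S c -> conductor S c' -> c = c'.
Proof.
move=> [Sc minc] [Sc' minc']; apply/ffunP => i.
by apply/eqP; rewrite eqn_leq (minc _ Sc') (minc' _ Sc).
Qed.

Section Descriptor.
Variables (s : nat) (T : descriptor).
Hypothesis hT : is_descriptor s T.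

Lemma is_multseq_Mseq i : 1 <= i <= s -> is_multseq (Mseq T i).
Proof. by case: hT => sM _ MM _ ?; apply/MM/mem_nth; rewrite sM; lia. Qed.

Lemma pglue_gt0 i : 1 <= i < s -> 0 < pglue T i.
Proof. by case: hT => _ sp _ pp ?; apply/pp/mem_nth; rewrite sp; lia. Qed.

Lemma pglue_last : pglue T s = 0.
Proof. by case: hT => _ sp _ _; rewrite /pglue nth_default // sp. Qed.

Let M (i : 'I_s) : seq nat := Mseq T i.+1.

Let hM (i : 'I_s) : is_multseq (M i).
Proof. by apply: is_multseq_Mseq; have := ltn_ord i; lia. Qed.

(** A branch joined to a distant one is joined at the same level to its neighbour on that side. *)
Lemma joined_level (i h : 'I_s) l : i <> h -> joined T i h l -> l <= level T i.+1.
Proof.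
move=> ih jih; rewrite /level /=.
have [hi|hi|/ord_inj //] := ltngtP i h.
  by have := jih i; lia.
have := jih i.-1; rewrite prednK ?(leq_trans _ hi) //; lia.
Qed.

(** Compatibility is transitive, so it propagates along the consecutive branches in between, each
    glued at level at least [l]. *)
Lemma joined_compatible :
  (forall i, 1 <= i < s -> compatible (pglue T i) (Mseq T i) (Mseq T i.+1)) ->
  forall (i h : 'I_s) l, joined T i h l -> compatible l (M i) (M h).
Proof.
move=> cM.
have H (d a : nat) l : a + d < s -> joined T a (a + d) l ->
    compatible l (Mseq T a.+1) (Mseq T (a + d).+1).
  elim: d => [|d IH] ads jl; first by rewrite addn0.
  apply: (@compatible_trans _ _ (Mseq T (a + d).+1)).
    by apply: IH => [|k kad]; [lia|apply: jl; lia].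
  rewrite addnS; apply: (@compatible_le (pglue T (a + d).+1)).
    by apply: jl; lia.
  by apply: cM; lia.
move=> i h l jl; have [ih|hi] := leqP i h.
  have := H (h - i) i l; rewrite subnKC //; apply=> //; exact: ltn_ord.
apply: compatible_sym; have := H (i - h) h l; rewrite subnKC; last exact: ltnW.
by apply; [exact: ltn_ord|exact: joined_sym].
Qed.

Lemma untwisted_glued_joined (N : Defs.family s) :
  is_tree N -> untwisted N -> describes T N ->
  forall i h l, 0 < l -> glued N i h l <-> joined T i h l.
Proof.
move=> treeN uN [_ pN].
have next (i h : 'I_s) l : h = i.+1 :> nat -> 0 < l ->
    glued N i h l <-> l <= pglue T i.+1.
  move=> hi l0; have [p0 gp pmax] := pN i h hi.
  by split=> [/pmax|lp]; [exact|exact: (glued_le treeN l0 lp gp)].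
have lt (i h : 'I_s) l : i < h -> 0 < l -> glued N i h l <-> joined T i h l.
  move=> ih l0; have [hi|hi] := eqVneq (h : nat) i.+1.
    by rewrite next // hi joined_next.
  rewrite uN //; last lia.
  split=> [H k ikh|jl k k' ik kh kk'].
    have kh : k < h by lia.
    have k1s : k.+1 < s by have := ltn_ord h; lia.
    have [|||l' ll' g] := H (Ordinal (ltnW k1s)) (Ordinal k1s) => //=; first lia.
    apply: (leq_trans ll').
    exact: (next (Ordinal (ltnW k1s)) (Ordinal k1s) l' (erefl _) (leq_trans l0 ll')).1 g.
  exists l => //; apply: (next _ _ _ kk' l0).2; apply: jl; lia.
move=> i h l l0; have [ih|hi|/ord_inj->] := ltngtP i h; first exact: lt.
  split=> [/esym|/joined_sym]; first by move=> /(lt h i l hi l0)/joined_sym.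
  by move=> /(lt h i l hi l0)/esym.
by split=> // _; apply: joined_refl.
Qed.

(** The tree with descriptor [T]. Coordinate [h] is read from the sequence of branch [h], so joined
    branches get literally the same vector. *)
Definition tree_of : Defs.family s := fun i j =>
  [ffun h : 'I_s => if `[< joined T i h j >] then entry (M h) j else 0].

Lemma tree_of_glued i h l : 0 < l -> glued tree_of i h l <-> joined T i h l.
Proof.
move=> l0; split=> [/ffunP/(_ h)|jih].
  rewrite !ffunE (asboolT (@joined_refl T h l)); case: asboolP => // _ E.
  by have := entry_gt0 (hM h) l0; rewrite -E.
apply/ffunP => k; rewrite !ffunE; congr (if _ then _ else _).
by apply: asbool_equiv_eq; split; apply: joined_trans; [exact: joined_sym|].
Qed.

Lemma tree_of_is_tree : is_tree tree_of.
Proof.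
split=> [i h|i h j j0].
  apply/tree_of_glued => // k kih; apply: pglue_gt0.
  by have := ltn_ord i; have := ltn_ord h; lia.
move/tree_of_glued=> jih; apply/tree_of_glued => //.
by apply: joined_le (jih _) => //.
Qed.

Lemma tree_of_eq0 i j h : 1 <= j -> tree_of i j h = 0 <-> ~ glued tree_of i h j.
Proof.
move=> j0; rewrite tree_of_glued // ffunE; case: asboolP => // jih.
by split=> // E; have := entry_gt0 (hM h) j0; rewrite E.
Qed.

Lemma tree_of_entry i j : 1 <= j -> entry (M i) j = tree_of i j i.
Proof. by rewrite ffunE (asboolT (@joined_refl T i j)). Qed.

Lemma tree_of_unit : exists L, forall m, L <= m -> forall i,
  tree_of i m = [ffun h => (h == i) : nat].
Proof.
exists (\max_(i < s) level T i.+1).+1 => m Lm i; apply/ffunP => h; rewrite !ffunE.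
have lm (k : 'I_s) : level T k.+1 < m.
  by apply: leq_ltn_trans Lm; apply: (leq_bigmax_cond (F := fun k : 'I_s => level T k.+1)).
case: eqVneq => [->|/eqP hi].
  rewrite (asboolT (@joined_refl T i m)) entry_tail //.
  by apply: leq_ltn_trans (lm i); rewrite leq_maxl.
case: asboolP => // jih.
by have := joined_level (nesym hi) jih; rewrite leqNgt lm.
Qed.

Lemma tree_of_untwisted : untwisted tree_of.
Proof.
move=> i j l ij l0; rewrite tree_of_glued //; split=> [jl k k' ik kj kk'|H k kij].
  by exists l => //; apply/tree_of_glued => //; rewrite kk' joined_next; apply: jl; lia.
have kj : k < j by lia.
have k1s : k.+1 < s by have := ltn_ord j; lia.
have [|||l' ll' g] := H (Ordinal (ltnW k1s)) (Ordinal k1s) => //=; first lia.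
apply: (leq_trans ll'); apply/joined_next.
by move/tree_of_glued: g; apply; apply: leq_trans ll'.
Qed.

Lemma tree_of_describes : describes T tree_of.
Proof.
split=> [i j|i h hi]; first exact: tree_of_entry.
have p0 : 0 < pglue T i.+1 by apply: pglue_gt0; have := ltn_ord h; lia.
split=> // [|l l0]; rewrite tree_of_glued // hi; first exact/joined_next.
by move/joined_next.
Qed.

Hypothesis s_gt1 : 1 < s.

(** The maximum defining [level] is attained by the length or by the glueing with a neighbour. In
    the first case the sequence is not the constant one, whose length 1 never exceeds a glueing
    level. *)
Lemma level_joined (i : 'I_s) :
  (level T i.+1 = size (M i) /\ last 1 (M i) <> 1) \/
  exists2 h : 'I_s, i <> h & joined T i h (level T i.+1).
Proof.
have is_ := ltn_ord i; rewrite /level /= -/(M i).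
have p0 : 0 < maxn (pglue T i) (pglue T i.+1).
  have [i0|i0] := posnP i; last by have := @pglue_gt0 i; lia.
  by have := @pglue_gt0 i.+1; lia.
have [lq|ql] := leqP (size (M i)) (maxn (pglue T i) (pglue T i.+1)); last first.
  left; split; first by [].
  by case: (hM i) => -[E|//] _ _ _; rewrite E /= in ql; lia.
right; have [pp|pp] := leqP (pglue T i) (pglue T i.+1).
  (* The right neighbour exists: on the last branch the right glueing level is the default 0. *)
  have i1s : i.+1 < s.
    rewrite ltnNge; apply/negP => si; have E : i.+1 = s by lia.
    by move: p0 pp; rewrite E pglue_last; lia.
  exists (Ordinal i1s); first by move/(congr1 val) => /=; lia.
  by apply/joined_next; lia.
have i_gt0 : 0 < i by rewrite lt0n; apply: contraTneq pp => ->; rewrite -leqNgt.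
have i1s : i.-1 < s by lia.
exists (Ordinal i1s); first by move/(congr1 val) => /=; lia.
apply: joined_sym; rewrite -[X in joined _ _ X](prednK i_gt0).
by apply/joined_next; rewrite prednK //; lia.
Qed.

Section GluedJoined.
Variable N : Defs.family s.
Hypothesis treeN : is_tree N.
Hypothesis N_eq0 : forall i j h, 1 <= j -> N i j h = 0 <-> ~ glued N i h j.
Hypothesis entryM : forall i j, 1 <= j -> entry (M i) j = N i j i.
Hypothesis gluedP : forall i h l, 0 < l -> glued N i h l <-> joined T i h l.

Lemma semigroup_of_conductor_level :
  conductor (semigroup_of N) [ffun i : 'I_s => psum (M i) (level T i.+1)].
Proof.
have sz (i : 'I_s) : size (M i) <= level T i.+1 by rewrite leq_maxl.
have lv (i : 'I_s) : 0 < level T i.+1 by rewrite (leq_trans (size_multseq (hM i))).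
apply: (semigroup_of_conductor treeN N_eq0 entryM hM (d := fun i => level T i.+1)) => //.
  by move=> i h l ih l0 /(gluedP _ _ l0); apply: joined_level.
move=> i; have [?|[h ih jih]] := level_joined i; first by left.
by right; exists h => //; apply/gluedP.
Qed.

End GluedJoined.

End Descriptor.

(** Reduces [Cond] to arithmetic on descriptors. In one direction the glueings of the tree are those
    read off [T] and the conductor is unique; in the other [tree_of] is a witness. *)
Lemma CondP u T : 1 < size u ->
  Cond u T <-> [/\ is_descriptor (size u) T,
    (forall i, 1 <= i < size u ->
       compatible (pglue T i) (Mseq T i) (Mseq T i.+1)) &
    (forall i, 1 <= i <= size u -> comp_at u i = psum (Mseq T i) (level T i))].
Proof.
move=> u1; split=> [[hT [N [uN dN [S [_ _ _ [[treeN _ N0 sumN] ->] condS]]]]]|].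
  have [eN pN] := dN; have hM := fun i : 'I_(size u) =>
    @is_multseq_Mseq _ _ hT i.+1 (ltn_ord i).
  have gP := untwisted_glued_joined treeN uN dN.
  split=> // i iu.
    have i1 : i.-1 < size u by lia.
    have i2 : i < size u by lia.
    have [|p0 g _] := pN (Ordinal i1) (Ordinal i2); first by rewrite /=; lia.
    have := glued_compatible treeN N0 eN hM sumN p0 g.
    by rewrite /= prednK //; lia.
  have i1 : i.-1 < size u by lia.
  have := semigroup_of_conductor_level hT u1 treeN N0 eN gP.
  move/(conductor_unique condS)/ffunP/(_ (Ordinal i1)); rewrite !ffunE /= prednK //.
  lia.
case=> hT cM cu; split=> //; exists (@tree_of (size u) T).
have treeN := tree_of_is_tree hT; have N0 := tree_of_eq0 hT.
have eN := @tree_of_entry (size u) T.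
have gP := tree_of_glued hT.
have hM := fun i : 'I_(size u) => @is_multseq_Mseq _ _ hT i.+1 (ltn_ord i).
have cG h h' l : 0 < l -> glued (@tree_of (size u) T) h h' l ->
    compatible l (Mseq T h.+1) (Mseq T h'.+1).
  by move=> l0 /(gP _ _ _ l0); apply: joined_compatible.
have condN : conductor (semigroup_of (@tree_of (size u) T))
    [ffun i : 'I_(size u) => comp_at u i.+1].
  have -> : [ffun i : 'I_(size u) => comp_at u i.+1] =
      [ffun i : 'I_(size u) => psum (Mseq T i.+1) (level T i.+1)].
    by apply/ffunP => i; rewrite !ffunE cu //; have := ltn_ord i; lia.
  exact: (semigroup_of_conductor_level hT u1 treeN N0 eN gP).
split; [exact: tree_of_untwisted|exact: tree_of_describes|].
exists (semigroup_of (@tree_of (size u) T)); split=> //.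
- exact: (semigroup_of_good treeN N0 eN hM cG condN).
- exact: (semigroup_of_local treeN N0 eN hM).
- exact: (semigroup_of_arf treeN N0 eN hM cG).
split=> //; split=> //; first exact: tree_of_unit.
exact: compatible_sum_node treeN N0 eN hM cG.
Qed.

(** * Arf numerical semigroups, the case of a single branch *)

Lemma numerical_ofP M n : numerical_of M n <-> exists e, n = psum M e.
Proof.
split=> [[[j jM ->]|nM]|[e ->]].
- by exists j; rewrite psum_take.
- exists (size M + (n - sumn M)); rewrite psum_tail // psum_size; lia.
have [eM|Me] := leqP e (size M); first by left; exists e => //; rewrite psum_take.
right; rewrite -psum_size -(subnKC (ltnW Me)) psum_tail //; lia.
Qed.

(** If the integer before the total sum were an element, it would be the partial sum omitting the
    last entry, which would then be 1. *)
Lemma conductor_numerical_of M : is_multseq M ->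
  conductor_numerical (numerical_of M) (if M == [:: 1] then 0 else sumn M).
Proof.
move=> hM; case: eqP => [->|M1]; split=> //=.
- by move=> [|n] _; [left; exists 0|case: n => [|n]; [left; exists 1|right]].
- move=> n; rewrite leq_eqVlt => /predU1P[<-|]; last by right.
  by left; exists (size M); rewrite ?take_size.
move=> n /= Sn; rewrite leqNgt; apply/negP => nM.
have lM : last 1 M <> 1 by case: hM => -[].
have /numerical_ofP[e E] : numerical_of M (sumn M).-1 by apply: Sn; lia.
have sE : sumn M = (psum M e).+1 by lia.
have eM : e < size M by rewrite -(ltn_psum hM) psum_size sE.
have : psum M e.+1 <= psum M (size M) by rewrite leq_psum.
rewrite psum_size sE psumS => pe.
have e1 : entry M e.+1 = 1 by have := entry_gt0 hM (ltn0Sn e); lia.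
apply: lM; rewrite -nth_last; suff -> : (size M).-1 = e by [].
have : psum M (size M) = psum M e.+1 by rewrite psum_size sE psumS e1 addn1.
by move/(psum_inj hM)=> ->.
Qed.

Lemma numerical_of_arf M : is_multseq M -> arf_numerical (numerical_of M).
Proof.
move=> hM a Sa; split=> /= [|x y]; first by rewrite [_ + _]addn0.
have /numerical_ofP[e ->] := Sa.
move=> /numerical_ofP[e1 E1] /numerical_ofP[e2 E2].
have [||f _ hf] := psum_arf hM (e := e) (a := e1) (b := e2).
- by rewrite -(leq_psum hM) -E1 leq_addr.
- by rewrite -(leq_psum hM) -E2 leq_addr.
apply/numerical_ofP; exists f; apply/eqP; rewrite -(eqn_add2l (psum M e)) -hf -E1 -E2.
by apply/eqP; rewrite -addnA; congr (_ + _); apply: addnCA.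
Qed.

Lemma Cond1P M n :
  Cond1 n M <-> is_multseq M /\ n = if M == [:: 1] then 0 else sumn M.
Proof.
split=> [[hM [S [_ _ -> [Sn nmin]]]]|[hM ->]]; split=> //.
  have [Sc cmin] := conductor_numerical_of hM.
  by apply/eqP; rewrite eqn_leq nmin // cmin.
exists (numerical_of M); split=> //; last exact: conductor_numerical_of.
  have S0 : numerical_of M 0 by left; exists 0; rewrite ?take0.
  split; first split=> // a b Sa Sb.
    by have [_ add] := numerical_of_arf hM S0; exact: (add a b).
  apply: (sub_finite_set _ (finite_II (sumn M).+1)) => x /= xS.
  by rewrite ltnNge; apply/negP => Mx; apply: xS; right.
exact: numerical_of_arf.
Qed.

Lemma sumn_multseq_gt1 M : is_multseq M -> M != [:: 1] -> 1 < sumn M.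
Proof.
move=> hM /eqP M1; have s0 := size_multseq hM.
have lM : last 1 M <> 1 by case: hM => -[].
have E : sumn M = psum M (size M).-1 + last 1 M.
  by rewrite -psum_size -nth_last -[in LHS](prednK s0) psumS prednK.
have : 0 < last 1 M by rewrite -nth_last; exact: (entry_gt0 hM s0).
by move: lM E; lia.
Qed.

(** The starred convention moves [[:: 1]] from its conductor 0 to the value 1, its sum; all other
    sequences have sum greater than 1. *)
Lemma Cond1starP M n : 0 < n -> Cond1star n M <-> is_multseq M /\ n = sumn M.
Proof.
move=> n0; rewrite /Cond1star; case: (eqVneq n 1) => [->|/eqP n1]; rewrite Cond1P;
  split=> -[hM E]; split=> //; move: E; case: eqVneq => [-> /=|/(sumn_multseq_gt1 hM)]; lia.
Qed.

(** * Restriction to consecutive branches *)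

(** The [level] of branch [i] in T_[a,b], in the numbering of [T]: the glueings across the two ends
    are dropped. *)
Definition segment_level (T : descriptor) (a b i : nat) : nat :=
  maxn (size (Mseq T i)) (maxn (if a < i then pglue T i.-1 else 0)
                               (if i < b then pglue T i else 0)).

(** The conditions of [CondP] for T_[a,b] without a shift of indices; [v] is a function so that one
    component can be changed easily. *)
Definition segment_conductor (T : descriptor) (a b : nat) (v : nat -> nat) : Prop :=
  (forall i, a <= i < b -> compatible (pglue T i) (Mseq T i) (Mseq T i.+1)) /\
  (forall i, a <= i <= b -> v i = psum (Mseq T i) (segment_level T a b i)).

(** On a single branch both glueing levels are the default 0, so [level] is the length and the
    description of [CondP] persists. *)
Lemma DP u T : 0 < size u -> (forall i, 1 <= i <= size u -> 1 <= comp_at u i) ->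
  D u T <-> [/\ is_descriptor (size u) T,
    (forall i, 1 <= i < size u ->
       compatible (pglue T i) (Mseq T i) (Mseq T i.+1)) &
    (forall i, 1 <= i <= size u -> comp_at u i = psum (Mseq T i) (level T i))].
Proof.
move=> u0 upos; rewrite /D; case: eqVneq => u1; last by apply: CondP; lia.
have up : 0 < comp_at u 1 by apply: upos; lia.
rewrite u1; split=> [[M /(Cond1starP _ up)[hM uM] <-]|].
  split; first by split=> // M'; rewrite mem_seq1 => /eqP->.
    by move=> i; lia.
  move=> i i1; have -> : i = 1 by lia.
  by rewrite /level /= !maxn0 uM psum_size.
case: T => [[|M [|? ?]] [|? ?]] [] [] //= _ _ hM _ _ /(_ 1 isT).
rewrite /level /= !maxn0 psum_size => uM; exists M => //.
by apply/(Cond1starP _ up); split=> //; apply: hM; rewrite mem_seq1.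
Qed.

Lemma nth_slice (X : Type) (x0 : X) (x : seq X) a b i :
  0 < a -> a <= i <= b -> nth x0 (slice x a b) (i - a) = nth x0 x i.-1.
Proof.
by move=> a0 aib; rewrite /slice nth_drop nth_take; [congr nth|]; lia.
Qed.

Lemma size_slice (X : Type) (x : seq X) a b :
  b <= size x -> size (slice x a b) = b - a.-1.
Proof. by move=> bx; rewrite /slice size_drop size_takel. Qed.

Lemma comp_at_slice c a b i : 0 < a -> a <= i <= b ->
  comp_at (slice c a b) (i - a).+1 = comp_at c i.
Proof. exact: nth_slice. Qed.

Section Segments.
Variables (r : nat) (T : descriptor).
Hypothesis hT : is_descriptor r T.

Section Subdesc.
Variables a b : nat.
Hypotheses (a0 : 0 < a) (ab : a <= b) (br : b <= r).

Lemma Mseq_subdesc i : a <= i <= b ->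
  Mseq (subdesc T a b) (i - a).+1 = Mseq T i.
Proof. exact: nth_slice. Qed.

Lemma pglue_subdesc i : a <= i < b ->
  pglue (subdesc T a b) (i - a).+1 = pglue T i.
Proof. by move=> aib; apply: nth_slice => //; lia. Qed.

Lemma pglue_subdesc_last : pglue (subdesc T a b) (b - a).+1 = 0.
Proof.
by case: hT => _ sp _ _; rewrite /pglue nth_default //= size_slice ?sp; lia.
Qed.

Lemma subdesc_is_descriptor : is_descriptor (b - a).+1 (subdesc T a b).
Proof.
case: hT => sM sp MM pp; split=> /=; [rewrite size_slice ?sM; lia| | |].
- by rewrite size_slice ?sp; lia.
- by move=> M /mem_drop /mem_take /MM.
- by move=> p /mem_drop /mem_take /pp.
Qed.

Lemma level_subdesc i : a <= i <= b ->
  level (subdesc T a b) (i - a).+1 = segment_level T a b i.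
Proof.
move=> aib; rewrite /level /segment_level Mseq_subdesc //=.
have -> : pglue (subdesc T a b) (i - a).+1 = if i < b then pglue T i else 0.
  case: ltnP => ib; first by apply: pglue_subdesc; lia.
  have -> : i = b by lia.
  exact: pglue_subdesc_last.
case: (ltnP a i) => ai.
  rewrite -(@pglue_subdesc i.-1); last lia.
  by have -> : (i.-1 - a).+1 = i - a by lia.
(* On the first branch [pglue _ 0] reads the same entry as [pglue _ 1], so the maximum is that of
   the right glueing alone. *)
have -> : i = a by lia.
rewrite subnn max0n; congr maxn; case: ltnP => ab'.
  have -> : pglue (subdesc T a b) 0 = pglue (subdesc T a b) (a - a).+1 by rewrite subnn.
  by rewrite pglue_subdesc ?maxnn //; lia.
have -> : pglue (subdesc T a b) 0 = pglue (subdesc T a b) (b - a).+1.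
  by have -> : b - a = 0 by lia.
by rewrite pglue_subdesc_last.
Qed.

Lemma segment_conductorP (u : seq nat) (v : nat -> nat) :
  size u = (b - a).+1 ->
  (forall i, a <= i <= b -> comp_at u (i - a).+1 = v i) ->
  [/\ is_descriptor (size u) (subdesc T a b),
    (forall i, 1 <= i < size u -> compatible (pglue (subdesc T a b) i)
       (Mseq (subdesc T a b) i) (Mseq (subdesc T a b) i.+1)) &
    (forall i, 1 <= i <= size u -> comp_at u i =
       psum (Mseq (subdesc T a b) i) (level (subdesc T a b) i))] <->
  segment_conductor T a b v.
Proof.
move=> su uv; rewrite su; split=> [[_ cM cu]|[cM cv]].
  split=> i aib.
    have := cM (i - a).+1; rewrite -subSn ?Mseq_subdesc; try lia.
    by rewrite subSn ?Mseq_subdesc ?pglue_subdesc; [apply|..]; lia.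
  by rewrite -uv // cu ?Mseq_subdesc ?level_subdesc //; lia.
split; first exact: subdesc_is_descriptor.
  move=> i ib; have := cM (a + i.-1).
  rewrite -Mseq_subdesc -?pglue_subdesc -1?Mseq_subdesc; try lia.
  have -> : (a + i.-1 - a).+1 = i by lia.
  have -> : ((a + i.-1).+1 - a).+1 = i.+1 by lia.
  by apply; lia.
move=> i ib; have := cv (a + i.-1); rewrite -uv; last lia.
rewrite -level_subdesc; last lia.
rewrite -Mseq_subdesc; last lia.
have -> : (a + i.-1 - a).+1 = i by lia.
by apply; lia.
Qed.

Lemma Cond_subdesc (u : seq nat) (v : nat -> nat) : a < b ->
  size u = (b - a).+1 ->
  (forall i, a <= i <= b -> comp_at u (i - a).+1 = v i) ->
  Cond u (subdesc T a b) <-> segment_conductor T a b v.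
Proof.
by move=> ab' su uv; rewrite -(segment_conductorP su uv); apply: CondP; lia.
Qed.

Lemma D_subdesc (u : seq nat) (v : nat -> nat) :
  (forall i, a <= i <= b -> 0 < v i) ->
  size u = (b - a).+1 ->
  (forall i, a <= i <= b -> comp_at u (i - a).+1 = v i) ->
  D u (subdesc T a b) <-> segment_conductor T a b v.
Proof.
move=> v0 su uv; rewrite -(segment_conductorP su uv); apply: DP; first by rewrite su.
move=> i iu; have := v0 (a + i.-1); rewrite -uv; last lia.
have -> : (a + i.-1 - a).+1 = i by lia.
by apply; lia.
Qed.

End Subdesc.

Lemma level_segment i : 1 < r -> 1 <= i <= r -> level T i = segment_level T 1 r i.
Proof.
move=> r1 ir; rewrite /level /segment_level; congr maxn.
have <- : pglue T i = if i < r then pglue T i else 0.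
  case: ltnP => // ri; have -> : i = r by lia.
  exact: pglue_last hT.
case: (ltnP 1 i) => // i1; have -> : i = 1 by lia.
by rewrite max0n; apply: maxnn.
Qed.

Lemma Cond_segment c : size c = r -> 1 < r ->
  Cond c T <-> segment_conductor T 1 r (comp_at c).
Proof.
move=> sc r1; rewrite CondP ?sc //; split=> [[_ cM cc]|[cM cc]].
  by split=> // i ir; rewrite cc ?level_segment.
by split=> // i ir; rewrite cc ?level_segment.
Qed.

Section Split.
Variable m : nat.
Hypothesis mr : 1 <= m < r.

Lemma pstarl_segment : pstarl T m = segment_level T 1 m m.
Proof.
rewrite /pstarl /segment_level ltnn maxn0; case: eqVneq => [->|m1].
  by rewrite maxn0.
by have -> : 1 < m by lia.
Qed.

Lemma pstarr_segment : pstarr r T m = segment_level T m.+1 r m.+1.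
Proof.
rewrite /pstarr /segment_level ltnn max0n; case: eqVneq => [mr'|mr'].
  have -> : m.+1 < r = false by lia.
  by rewrite maxn0; congr (size (Mseq _ _)); lia.
by have -> : m.+1 < r by lia.
Qed.

(** Only branches [m] and [m.+1] see the glueing between them; their levels in the two halves are
    [pstarl T m] and [pstarr r T m]. *)
Lemma segment_conductor_split v :
  segment_conductor T 1 r v <->
  [/\ compatible (pglue T m) (Mseq T m) (Mseq T m.+1),
    segment_conductor T 1 m
      (fun i => if i == m then psum (Mseq T m) (pstarl T m) else v i),
    segment_conductor T m.+1 r
      (fun i => if i == m.+1 then psum (Mseq T m.+1) (pstarr r T m) else v i),
    v m = psum (Mseq T m) (maxn (pstarl T m) (pglue T m)) &
    v m.+1 = psum (Mseq T m.+1) (maxn (pstarr r T m) (pglue T m))].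
Proof.
have lm : segment_level T 1 r m = maxn (pstarl T m) (pglue T m).
  rewrite pstarl_segment /segment_level ltnn maxn0 -maxnA.
  by case/andP: mr => _ ->.
have lm1 : segment_level T 1 r m.+1 = maxn (pstarr r T m) (pglue T m).
  rewrite pstarr_segment /segment_level ltnn max0n -maxnA [maxn _ (pglue T m)]maxnC.
  by have -> : 1 < m.+1 by lia.
have ll i : i < m -> segment_level T 1 m i = segment_level T 1 r i.
  by move=> im; rewrite /segment_level im (_ : i < r) //; lia.
have lr i : m.+1 < i -> segment_level T m.+1 r i = segment_level T 1 r i.
  by move=> mi; rewrite /segment_level mi (_ : 1 < i) //; lia.
split=> [[cM cv]|[cm [cl vl] [cr vr] vm vm1]].
  split; rewrite -?lm -?lm1; [by apply: cM|split|split|by apply: cv; lia..].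
  - by move=> i im; apply: cM; lia.
  - move=> i im; case: eqVneq => [->|ne]; first by rewrite pstarl_segment.
    by rewrite ll ?cv; lia.
  - by move=> i im; apply: cM; lia.
  - move=> i im; case: eqVneq => [->|ne]; first by rewrite pstarr_segment.
    by rewrite lr ?cv; lia.
split=> i ir.
  have [im|im|->//] := ltngtP i m; first by apply: cl; lia.
  by apply: cr; lia.
have [->|im] := eqVneq i m; first by rewrite lm.
have [->|im1] := eqVneq i m.+1; first by rewrite lm1.
have [lt|lt] := ltnP i m.
  by have := vl i; rewrite (negPf im) ll //; apply; lia.
by have := vr i; rewrite (negPf im1) lr; [apply; lia|lia].
Qed.

End Split.

Lemma segment_conductor_ext a b v v' :
  (forall i, a <= i <= b -> v i = v' i) ->
  segment_conductor T a b v -> segment_conductor T a b v'.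
Proof. by move=> vv' [cM cv]; split=> // i ib; rewrite -vv' ?cv. Qed.

End Segments.

Definition update (v : nat -> nat) (m x i : nat) : nat := if i == m then x else v i.

Lemma update_eq v m x i : v m = x -> update v m x i = v i.
Proof. by move=> <-; rewrite /update; case: eqVneq => [->|]. Qed.

(** Since the tail entries are 1, levels and conductors shift by the same amount; this produces the
    differences c[t+1] - k and c[t-1] - k. *)
Lemma psum_maxn_tail M q p : size M <= q -> psum M (maxn q p) = psum M q + (p - q).
Proof. by move=> Mq; rewrite maxnE psum_tail. Qed.

(** * The four sets of the decomposition as conditions on segments *)

Section Pieces.
Variables (r : nat) (c : seq nat) (t : nat) (T : descriptor).
Hypotheses (sc : size c = r) (hc : forall i, 1 <= i <= r -> 1 <= comp_at c i).
Hypothesis ht : 2 <= t <= r.-1.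
Hypothesis hT : is_descriptor r T.

Let v := comp_at c.

Let Comp_compatible i : 1 <= i < r ->
  le_ext (pglue T i) (Comp (Mseq T i) (Mseq T i.+1)) <->
  compatible (pglue T i) (Mseq T i) (Mseq T i.+1).
Proof. by move=> ir; apply: le_ext_CompP; apply: (is_multseq_Mseq hT); lia. Qed.

Lemma S11P : S11 c t T <->
  [/\ segment_conductor T 1 t v, segment_conductor T t.+1 r v,
    1 <= pglue T t <= minn (pstarl T t) (pstarr r T t) &
    compatible (pglue T t) (Mseq T t) (Mseq T t.+1)].
Proof.
rewrite /S11 /= sc; have /Comp_compatible E : 1 <= t < r by lia.
have EC : Cond (slice c 1 t) (subdesc T 1 t) <-> segment_conductor T 1 t v.
  by apply: (Cond_subdesc hT) => [|||||i]; rewrite ?size_slice ?sc; try lia;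
    apply: comp_at_slice.
have ED : D (slice c t.+1 r) (subdesc T t.+1 r) <-> segment_conductor T t.+1 r v.
  apply: (D_subdesc hT) => [|||i ir||i]; rewrite ?size_slice ?sc; try lia.
    by apply: hc; lia.
  exact: comp_at_slice.
by split=> [[_ /EC ? /ED ? ? /E]|[/EC ? /ED ? ? /E]].
Qed.

Lemma I1P k : 0 < k -> I1 c t k T <->
  [/\ segment_conductor T 1 t v, segment_conductor T t.+1 r (update v t.+1 k),
    pglue T t = pstarr r T t + (v t.+1 - k), pglue T t <= pstarl T t &
    compatible (pglue T t) (Mseq T t) (Mseq T t.+1)].
Proof.
move=> k0; rewrite /I1 /= sc; have /Comp_compatible E : 1 <= t < r by lia.
have EC : Cond (slice c 1 t) (subdesc T 1 t) <-> segment_conductor T 1 t v.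
  by apply: (Cond_subdesc hT) => [|||||i]; rewrite ?size_slice ?sc; try lia;
    apply: comp_at_slice.
have ED : D (k :: slice c t.+2 r) (subdesc T t.+1 r) <->
    segment_conductor T t.+1 r (update v t.+1 k).
  apply: (D_subdesc hT) => [|||i ir||i ir]; rewrite /= ?size_slice ?sc; try lia.
    by rewrite /update; case: eqP => // _; apply: hc; lia.
  rewrite /update; case: eqVneq => [->|ne]; first by rewrite subnn.
  rewrite /v -(@comp_at_slice c t.+2 r) //; last lia.
  by have -> : i - t.+1 = (i - t.+2).+1 by lia.
by split=> [[_ /EC ? /ED ? ? [? /E]]|[/EC ? /ED ? ? ? /E]].
Qed.

Lemma S21P : S21 c t T <->
  [/\ segment_conductor T t r v, segment_conductor T 1 t.-1 v,
    1 <= pglue T t.-1 <= minn (pstarl T t.-1) (pstarr r T t.-1) &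
    compatible (pglue T t.-1) (Mseq T t.-1) (Mseq T t)].
Proof.
rewrite /S21 /= sc; have /Comp_compatible : 1 <= t.-1 < r by lia.
rewrite prednK => [E|]; last lia.
have EC : Cond (slice c t r) (subdesc T t r) <-> segment_conductor T t r v.
  by apply: (Cond_subdesc hT) => [|||||i]; rewrite ?size_slice ?sc; try lia;
    apply: comp_at_slice; lia.
have ED : D (slice c 1 t.-1) (subdesc T 1 t.-1) <-> segment_conductor T 1 t.-1 v.
  apply: (D_subdesc hT) => [|||i ir||i]; rewrite ?size_slice ?sc; try lia.
    by apply: hc; lia.
  exact: comp_at_slice.
by split=> [[_ /EC ? /ED ? ? /E]|[/EC ? /ED ? ? /E]].
Qed.

Lemma I2P k : 0 < k -> I2 c t k T <->
  [/\ segment_conductor T t r v, segment_conductor T 1 t.-1 (update v t.-1 k),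
    pglue T t.-1 = pstarl T t.-1 + (v t.-1 - k), pglue T t.-1 <= pstarr r T t.-1 &
    compatible (pglue T t.-1) (Mseq T t.-1) (Mseq T t)].
Proof.
move=> k0; rewrite /I2 /= sc; have /Comp_compatible : 1 <= t.-1 < r by lia.
rewrite prednK => [E|]; last lia.
have EC : Cond (slice c t r) (subdesc T t r) <-> segment_conductor T t r v.
  by apply: (Cond_subdesc hT) => [|||||i]; rewrite ?size_slice ?sc; try lia;
    apply: comp_at_slice; lia.
have ED : D (rcons (slice c 1 t.-2) k) (subdesc T 1 t.-1) <->
    segment_conductor T 1 t.-1 (update v t.-1 k).
  apply: (D_subdesc hT) => [|||i ir||i ir]; rewrite ?size_rcons ?size_slice ?sc; try lia.
    by rewrite /update; case: eqP => // _; apply: hc; lia.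
  rewrite /comp_at nth_rcons size_slice ?sc /update; last lia.
  have [->|ne] := eqVneq i t.-1.
    have -> : (t.-1 - 1).+1.-1 = t.-2 - 1.-1 by lia.
    by rewrite ltnn eqxx.
  have -> : (i - 1).+1.-1 < t.-2 - 1.-1 by lia.
  by apply: (@comp_at_slice c 1) => //; lia.
by split=> [[_ /EC ? /ED ? ? [? /E]]|[/EC ? /ED ? ? ? /E]].
Qed.

End Pieces.

(** * Cutting between two consecutive branches *)

Section Decomposition.
Variables (r : nat) (T : descriptor) (v : nat -> nat) (m : nat).
Hypothesis hT : is_descriptor r T.
Hypothesis mr : 1 <= m < r.

Local Notation pm := (pglue T m).
Local Notation left_level := (pstarl T m).
Local Notation right_level := (pstarr r T m).

Lemma size_pstarl : size (Mseq T m) <= left_level.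
Proof. by rewrite (pstarl_segment T mr) leq_maxl. Qed.

Lemma size_pstarr : size (Mseq T m.+1) <= right_level.
Proof. by rewrite (pstarr_segment T mr) leq_maxl. Qed.

(** The cut leaves the level of branch [m] unchanged and lowers that of [m.+1] to [right_level]; [k]
    is the new component there. The truncated difference treats both positions of [pm] relative to
    [right_level]. *)
Lemma segment_conductor_cut_right : pm <= left_level ->
  segment_conductor T 1 r v <->
  exists2 k, v m.+1 = k + (pm - right_level) &
  [/\ compatible pm (Mseq T m) (Mseq T m.+1), segment_conductor T 1 m v &
    segment_conductor T m.+1 r (update v m.+1 k)].
Proof.
move=> pl; rewrite (segment_conductor_split T mr).
rewrite (maxn_idPl pl) (psum_maxn_tail _ size_pstarr).
split=> [[cm cl cr vm vm1]|[k vm1 [cm cl cr]]].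
  exists (psum (Mseq T m.+1) right_level) => //; split=> //.
  by apply: segment_conductor_ext cl => i _; apply: update_eq.
have vm : v m = psum (Mseq T m) left_level.
  by rewrite (pstarl_segment T mr); apply: cl.2; lia.
have kE : k = psum (Mseq T m.+1) right_level.
  by rewrite (pstarr_segment T mr) -cr.2 ?/update ?eqxx; lia.
split=> //; last by rewrite vm1 kE.
  by apply: segment_conductor_ext cl => i _; apply/esym/update_eq.
by rewrite -kE.
Qed.

Lemma segment_conductor_cut_left : pm <= right_level ->
  segment_conductor T 1 r v <->
  exists2 k, v m = k + (pm - left_level) &
  [/\ compatible pm (Mseq T m) (Mseq T m.+1), segment_conductor T m.+1 r v &
    segment_conductor T 1 m (update v m k)].
Proof.
move=> pl; rewrite (segment_conductor_split T mr).
rewrite (maxn_idPl pl) (psum_maxn_tail _ size_pstarl).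
split=> [[cm cl cr vm vm1]|[k vm [cm cr cl]]].
  exists (psum (Mseq T m) left_level) => //; split=> //.
  by apply: segment_conductor_ext cr => i _; apply: update_eq.
have vm1 : v m.+1 = psum (Mseq T m.+1) right_level.
  by rewrite (pstarr_segment T mr); apply: cr.2; lia.
have kE : k = psum (Mseq T m) left_level.
  by rewrite (pstarl_segment T mr) -cl.2 ?/update ?eqxx; lia.
split=> //; last by rewrite vm kE.
  by rewrite -kE.
by apply: segment_conductor_ext cr => i _; apply/esym/update_eq.
Qed.

Lemma psum_gt0 M n : is_multseq M -> 0 < n -> 0 < psum M n.
Proof. by move=> hM n0; rewrite -(psum0 M) ltn_psum. Qed.

Lemma segment_conductor_right_gt0 k :
  segment_conductor T m.+1 r (update v m.+1 k) -> 0 < k.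
Proof.
case=> _ /(_ m.+1); rewrite /update eqxx => ->; last lia.
have hM : is_multseq (Mseq T m.+1) by apply: (is_multseq_Mseq hT); lia.
by apply: psum_gt0 => //; rewrite leq_max (size_multseq hM).
Qed.

Lemma segment_conductor_left_gt0 k :
  segment_conductor T 1 m (update v m k) -> 0 < k.
Proof.
case=> _ /(_ m); rewrite /update eqxx => ->; last lia.
have hM : is_multseq (Mseq T m) by apply: (is_multseq_Mseq hT); lia.
by apply: psum_gt0 => //; rewrite leq_max (size_multseq hM).
Qed.

End Decomposition.

Theorem mainTheorem3 (r : nat) (hr : 3 <= r) (c : r.-tuple nat)
  (hc : forall i, 1 <= i <= r -> 1 <= comp_at c i)
  (t : nat) (ht : 2 <= t <= r.-1) :
  Cond c = S11 c t `|` S12 c t `|` S21 c t `|` S22 c t.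
Proof.
have sc : size c = r by rewrite size_tuple.
have tr : 1 <= t < r by lia.
have tr' : 1 <= t.-1 < r by lia.
have t1K : t.-1.+1 = t by lia.
have CondE T : is_descriptor r T ->
    Cond c T <-> segment_conductor T 1 r (comp_at c).
  by move=> hT; apply: Cond_segment => //; lia.
apply/predeqP => T; split=> [CT|].
  have hT : is_descriptor r T by rewrite -sc; case: CT.
  have segT := (CondE T hT).1 CT.
  (* The cut is made after [t] if its glueing does not determine the level of [t] from the right,
     and before [t] otherwise. *)
  have [pl|lp] := leqP (pglue T t) (pstarl T t).
    have [k vk [cm cl cr]] := (segment_conductor_cut_right _ tr pl).1 segT.
    have k0 := segment_conductor_right_gt0 hT tr cr.
    have [pr|rp] := leqP (pglue T t) (pstarr r T t).
      left; left; left; apply/(S11P sc hc ht hT); split=> //.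
        by apply: segment_conductor_ext cr => i _; apply: update_eq; lia.
      by rewrite leq_min pl pr (pglue_gt0 hT).
    left; left; right; exists k; first by rewrite /= vk; lia.
    by apply/(I1P sc hc ht hT k0); split=> //; lia.
  (* Now p_{t-1} <= [pstarl T t] < p_t, and p_t is one of the terms of [pstarr r T t.-1]. The bounds
     on [t] exclude the boundary cases of both definitions. *)
  have pr : pglue T t.-1 <= pstarr r T t.-1.
    move: lp; rewrite /pstarl /pstarr t1K.
    have -> : t == 1 = false by lia.
    have -> : t.-1 == r.-1 = false by lia.
    lia.
  have := (segment_conductor_cut_left _ tr' pr).1 segT.
  case=> [k vk [cm cr cl]]; have k0 := segment_conductor_left_gt0 hT tr' cl.
  rewrite t1K in cm cr; have [pl|rl] := leqP (pglue T t.-1) (pstarl T t.-1).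
    left; right; apply/(S21P sc hc ht hT); split=> //.
      by apply: segment_conductor_ext cl => i _; apply: update_eq; lia.
    by rewrite leq_min pl pr (pglue_gt0 hT).
  right; exists k; first by rewrite /= vk; lia.
  by apply/(I2P sc hc ht hT k0); split=> //; lia.
move=> TS; have hT : is_descriptor r T.
  by rewrite -sc; case: TS => [[[[]|[k _ []]]|[]]|[k _ []]].
apply/(CondE T hT); case: TS => [[[|[k /andP[k0 kv]]]|]|[k /andP[k0 kv]]].
- move/(S11P sc hc ht hT); rewrite leq_min => -[cl cr /and3P[_ pl pr] cm].
  (* Here p_t <= [pstarr r T t], so the truncated difference is 0 and the component is kept. *)
  apply/(segment_conductor_cut_right _ tr pl); exists (comp_at c t.+1); first lia.
  by split=> //; apply: segment_conductor_ext cr => i _; apply/esym/update_eq.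
- move/(I1P sc hc ht hT k0) => [cl cr pE pl cm].
  by apply/(segment_conductor_cut_right _ tr pl); exists k => //; lia.
- move/(S21P sc hc ht hT); rewrite leq_min => -[cr cl /and3P[_ pl pr] cm].
  apply/(segment_conductor_cut_left _ tr' pr); exists (comp_at c t.-1); first lia.
  rewrite t1K; split=> //.
  by apply: segment_conductor_ext cl => i _; apply/esym/update_eq.
- move/(I2P sc hc ht hT k0) => [cr cl pE pr cm].
  apply/(segment_conductor_cut_left _ tr' pr); exists k; first lia.
  by rewrite t1K.
Qed.
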